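(* Let $\mathfrak{g}$ be an affine Kac--Moody algebra over $\mathbb{C}$ with Cartan subalgebra $\mathfrak{h}$ and root system $\Phi$, and let $\mathfrak{s}\subseteq\mathfrak{g}$ be a regular subalgebra, i.e. a Lie subalgebra normalized by $\mathfrak{h}$. Let $$T=\{\alpha\in\Phi \mid \mathfrak{s}\cap\mathfrak{g}_\alpha\neq\{0\}\}$$ be the associated closed subset of $\Phi$. If $\mathfrak{s}$ is wide, that is, if every irreducible integrable highest weight $\mathfrak{g}$-module is indecomposable as an $\mathfrak{s}$-module upon restriction, then $$[T\cup(-T)]=\Phi,$$ where $[S]$ denotes the smallest closed subset of $\Phi$ containing $S$.
   Context: **Kac--Moody algebra.** Let $A=(a_{ij})$ be an $\ell\times\ell$ generalized Cartan matrix ($a_{ii}=2$; $a_{ij}\in\mathbb{Z}_{\le 0}$ for $i\ne j$; $a_{ij}=0\Rightarrow a_{ji}=0$) that is symmetrizable: there is a diagonal matrix $D=\mathrm{diag}(d_i)$ with all $d_i>0$ such that $DA$ is symmetric. A realization of $A$ is a triple $(\mathfrak{h},\Pi,\Pi^\vee)$ with $\mathfrak{h}$ a complex vector space of dimension $2\ell-\operatorname{rank}(A)$, and $\Pi=\{\alpha_1,\dots,\alpha_\ell\}\subset\mathfrak{h}^*$, $\Pi^\vee=\{\alpha_1^\vee,\dots,\alpha_\ell^\vee\}\subset\mathfrak{h}$ linearly independent sets with $\alpha_j(\alpha_i^\vee)=a_{ij}$. The associated symmetrizable Kac--Moody algebra $\mathfrak{g}=\mathfrak{g}(A)$ is the complex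 Lie algebra generated by $\mathfrak{h}$ and $e_i,f_i$ ($1\le i\le\ell$) with relations $[h,h']=0$, $[e_i,f_j]=\delta_{ij}\alpha_i^\vee$, $[h,e_i]=\alpha_i(h)e_i$, $[h,f_i]=-\alpha_i(h)f_i$ for $h,h'\in\mathfrak{h}$, and $(\operatorname{ad}e_i)^{1-a_{ij}}e_j=0=(\operatorname{ad}f_i)^{1-a_{ij}}f_j$ for $i\neq j$. The algebra $\mathfrak{g}$ is affine if $A$ is indecomposable and of affine type, i.e. its symmetrization $DA$ is positive semidefinite of corank $1$. **Roots.** $\mathfrak{g}=\mathfrak{h}\oplus\bigoplus_{\alpha\in\Phi}\mathfrak{g}_\alpha$, where $\mathfrak{g}_\alpha=\{x\in\mathfrak{g}\mid [h,x]=\alpha(h)x\ \forall h\in\mathfrak{h}\}$ and $\Phi\subset\mathfrak{h}^*\setminus\{0\}$ is the root system (containing both real and imaginary roots). **Closedness.** A subset $S\subseteq\Phi$ is closed if $\alpha,\beta\in S$ and $\alpha+\beta\in\Phi$ imply $\alpha+\beta\in S$. **Regular subalgebras.** A Lie subalgebra $\mathfrak{s}\subseteq\mathfrak{g}$ is regular if $[\mathfrak{h},\mathfrak{s}]\subseteq\mathfrak{s}$; then $\mathfrak{s}=(\mathfrak{s}\cap\mathfrak{h})\oplus\bigoplus_{\alpha\in\Phi}(\mathfrak{s}\cap\mathfrak{g}_\alpha)$. It is not assumed that $\mathfrak{h}\subseteq\mathfrak{s}$. **Modules.** A weight module is a $\mathfrak{g}$-module $V=\bigoplus_{\mu\in\mathfrak{h}^*}V_\mu$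 with $V_\mu=\{v\mid hv=\mu(h)v\ \forall h\in\mathfrak{h}\}$. It is a highest weight module of highest weight $\lambda$ if there is a nonzero $v_\lambda\in V$ with $e_iv_\lambda=0$ for all $i$, $hv_\lambda=\lambda(h)v_\lambda$ for all $h\in\mathfrak{h}$, and $V=U(\mathfrak{g})v_\lambda$. It is integrable if all $e_i$ and $f_i$ act locally nilpotently on $V$. A module is indecomposable if it is not a direct sum of two nonzero submodules. *)

(* Defs.v *)
From HB Require Import structures.
From mathcomp Require Import all_boot all_order all_algebra.
From mathcomp Require Import boolp classical_sets reals.
From mathcomp Require Import complex.

Set Implicit Arguments.
Unset Strict Implicit.
Unset Printing Implicit Defensive.

Import Order.TTheory GRing.Theory Num.Theory.

Local Open Scope classical_set_scope.
Local Open Scope ring_scope.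

HB.mixin Record Lmodule_isLieAlgebra (K : fieldType) (g : Type)
    of GRing.Lmodule K g := {
  lie : g -> g -> g;
  lie_linearl : forall y : g, linear (lie^~ y);
  lie_linearr : forall x : g, linear (lie x);
  liexx : forall x : g, lie x x = 0;
  jacobi : forall x y z : g,
    lie x (lie y z) + lie y (lie z x) + lie z (lie x y) = 0
}.

#[short(type="lieAlgType")]
HB.structure Definition LieAlgebra (K : fieldType) :=
  {g of GRing.Lmodule K g & Lmodule_isLieAlgebra K g}.

Definition subspace (K : fieldType) (V : lmodType K) (N : set V) : Prop :=
  N 0 /\ forall (a : K) (u v : V), N u -> N v -> N (a *: u + v).

Definition subalgebra (K : fieldType) (g : lieAlgType K) (s : set g) : Prop :=
  subspace s /\ forall x y : g, s x -> s y -> s (lie x y).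

Definition lie_morphism (K : fieldType) (g g' : lieAlgType K) (phi : g -> g') :
    Prop :=
  linear phi /\ forall x y : g, phi (lie x y) = lie (phi x) (phi y).

Definition is_gcm (l : nat) (A : 'M[int]_l) : Prop :=
  [/\ forall i, A i i = 2,
      forall i j, i != j -> A i j <= 0
    & forall i j, A i j = 0 -> A j i = 0].

Definition indecomposable_mx (l : nat) (A : 'M[int]_l) : Prop :=
  forall I : {set 'I_l}, I != finset.set0 -> I != [set: 'I_l]%SET ->
    exists i j, [/\ i \in I, j \notin I & A i j != 0].

Definition symmetrization (R : realType) (l : nat) (d : 'rV[R]_l)
    (A : 'M[int]_l) : 'M[R]_l :=
  diag_mx d *m map_mx intr A.

Definition psd (R : realType) (l : nat) (S : 'M[R]_l) : Prop :=
  forall x : 'cV[R]_l, 0 <= (x^T *m S *m x) ord0 ord0.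

Definition affine_gcm (R : realType) (l : nat) (A : 'M[int]_l) : Prop :=
  [/\ is_gcm A,
      indecomposable_mx A
    & exists d : 'rV[R]_l,
        [/\ forall i, 0 < d ord0 i,
            (symmetrization d A)^T = symmetrization d A,
            psd (symmetrization d A)
          & (\rank (symmetrization d A)).+1 = l]].

Record realization (K : fieldType) (l : nat) (A : 'M[int]_l) := Realization {
  cartan :> vectType K;
  simple_root : 'I_l -> 'Hom(cartan, K^o);
  simple_coroot : 'I_l -> cartan;
  dim_cartan :
    \dim {: cartan} = (2 * l - \rank (map_mx intr A : 'M[K]_l))%N;
  free_simple_root : free [tuple simple_root i | i < l];
  free_simple_coroot : free [tuple simple_coroot i | i < l];
  simple_rootE :
    forall i j, simple_root j (simple_coroot i) = (A i j)%:~R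
}.

Section KacMoody.
Variables (K : fieldType) (l : nat) (A : 'M[int]_l) (r : realization K A).

(* [`|1 - A i j|%N] is the exponent 1 - a_ij, a positive integer for i != j. *)
Definition km_relations (L : lieAlgType K) (h : r -> L) (e f : 'I_l -> L) :
    Prop :=
  (forall x y : r, lie (h x) (h y) = 0) /\
  (forall i j, lie (e i) (f j) = if i == j then h (simple_coroot r i) else 0) /\
  (forall x i, lie (h x) (e i) = (simple_root r i x : K) *: e i) /\
  (forall x i, lie (h x) (f i) = - ((simple_root r i x : K) *: f i)) /\
  (forall i j, i != j -> iter `|1 - A i j|%N (lie (e i)) (e j) = 0) /\
  (forall i j, i != j -> iter `|1 - A i j|%N (lie (f i)) (f j) = 0).

(* The Lie algebra presented by the generators r, e_i, f_i and the relations
   above: it is generated by them, and they can be mapped to any other solution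
   of the relations. The Cartan subalgebra is the image of [km_h]. *)
Record kac_moody := KacMoody {
  km_alg :> lieAlgType K;
  km_h : {linear r -> km_alg};
  km_e : 'I_l -> km_alg;
  km_f : 'I_l -> km_alg;
  km_rel : km_relations km_h km_e km_f;
  km_generated : forall s : set km_alg, subalgebra s ->
    (forall x, s (km_h x)) -> (forall i, s (km_e i)) ->
    (forall i, s (km_f i)) -> s = setT;
  km_universal : forall (L : lieAlgType K) (h : {linear r -> L})
      (e f : 'I_l -> L), km_relations h e f ->
    exists phi : km_alg -> L,
      [/\ lie_morphism phi,
          forall x, phi (km_h x) = h x,
          forall i, phi (km_e i) = e i
        & forall i, phi (km_f i) = f i]
}.

End KacMoody.

Record lie_module (K : fieldType) (g : lieAlgType K) := LieModule {
  module_sort :> lmodType K;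
  act : g -> module_sort -> module_sort;
  act_linearl : forall v, linear (act^~ v);
  act_linearr : forall x, linear (act x);
  act_lie : forall x y v, act (lie x y) v = act x (act y v) - act y (act x v)
}.

Section Modules.
Variables (K : fieldType) (g : lieAlgType K) (V : lie_module g).

(* Submodules for the restriction of the action to the subalgebra [s]. *)
Definition submodule_on (s : set g) (N : set V) : Prop :=
  subspace N /\ forall x v, s x -> N v -> N (act x v).

Definition submodule (N : set V) : Prop := submodule_on setT N.

Definition irreducible : Prop :=
  (exists v : V, v != 0) /\
  forall N : set V, submodule N -> N = [set 0] \/ N = setT.

Definition indecomposable_on (s : set g) : Prop :=
  forall N1 N2 : set V, submodule_on s N1 -> submodule_on s N2 ->
    (forall v : V, exists v1 v2, [/\ N1 v1, N2 v2 & v = v1 + v2]) ->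
    N1 `&` N2 = [set 0] ->
    N1 = [set 0] \/ N2 = [set 0].

(* U(g) v, i.e., the smallest submodule containing v. *)
Definition cyclic_submodule (v : V) : set V := smallest submodule [set v].

Definition locally_nilpotent (x : g) : Prop :=
  forall v : V, exists n : nat, iter n (act x) v = 0.

End Modules.

Section Roots.
Variables (K : fieldType) (l : nat) (A : 'M[int]_l) (r : realization K A).
Variable g : kac_moody r.

Local Notation weight := 'Hom(r, K^o).

Definition root_space (alpha : weight) : set g :=
  [set x | forall h : r, lie (km_h g h) x = (alpha h : K) *: x].

Definition root_system : set weight :=
  [set alpha | alpha != 0 /\ exists2 x, root_space alpha x & x != 0].

Definition closed_subset (S : set weight) : Prop :=
  S `<=` root_system /\
  forall alpha beta, S alpha -> S beta -> root_system (alpha + beta) ->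
    S (alpha + beta).

Definition closed_hull (S : set weight) : set weight :=
  smallest closed_subset S.

Definition regular_subalgebra (s : set g) : Prop :=
  subalgebra s /\ forall (h : r) (x : g), s x -> s (lie (km_h g h) x).

(* This set is not required to be closed. *)
Definition roots_of (s : set g) : set weight :=
  [set alpha | root_system alpha /\ s `&` root_space alpha != [set 0]].

Definition weight_space (V : lie_module g) (mu : weight) : set V :=
  [set v | forall h : r, act (km_h g h) v = (mu h : K) *: v].

(* V is the direct sum of its weight spaces: existence and uniqueness of
   finitely supported decompositions into weight vectors. *)
Definition weight_module (V : lie_module g) : Prop :=
  (forall v : V, exists (ms : seq weight) (u : weight -> V),
     (forall mu, weight_space mu (u mu)) /\ v = \sum_(mu <- ms) u mu) /\
  (forall (ms : seq weight) (u : weight -> V), uniq ms ->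
     (forall mu, weight_space mu (u mu)) -> \sum_(mu <- ms) u mu = 0 ->
     forall mu, mu \in ms -> u mu = 0).

Definition highest_weight_module (V : lie_module g) (lambda : weight) : Prop :=
  weight_module V /\
  exists v : V,
    [/\ v != 0,
        forall i, act (km_e g i) v = 0,
        weight_space lambda v
      & cyclic_submodule v = setT].

Definition integrable (V : lie_module g) : Prop :=
  forall i, locally_nilpotent V (km_e g i) /\ locally_nilpotent V (km_f g i).

Definition wide (s : set g) : Prop :=
  forall (V : lie_module g) (lambda : weight),
    irreducible V -> integrable V -> highest_weight_module V lambda ->
    indecomposable_on V s.

End Roots.

(* Main.v *)
(** Let Psi be the closed hull of T and -T.  It is symmetric, and the sum of the
    weight spaces of a weight module over a coset of the lattice Z Psi is stable
    under s.  In the irreducible module L(rho) the vectors v and f_i v are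
    nonzero of weights rho and rho - alpha_i, so wideness puts every simple root,
    hence the whole root lattice, in Z Psi.  It remains to see that a closed
    symmetric subset Psi of an affine root system contains every root that is a
    sum of elements of Psi.  For a real root x = sum of b_j, some (x, b_j) > 0,
    so x - b_j is a root or zero, which is a shorter sum.  For an isotropic root
    with a real summand b_j, some (b_j, b_k) < 0 and these two summands merge.
    If all the summands are isotropic, their partial sums are roots or zero,
    because every nonzero isotropic vector of the root lattice is a root.

    L(rho) is realized inside the contragredient Verma module of the Lie algebra
    without the Serre relations, as a space of functions on words in the simple
    indices; it is the submodule generated by the indicator of the empty word. *)
From HB Require Import structures.
Require Import Defs.
From mathcomp Require Import all_boot all_order all_algebra.
From mathcomp Require Import zify ring.
From mathcomp Require Import boolp classical_sets functions reals.
From mathcomp Require Import complex.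

Set Implicit Arguments.
Unset Strict Implicit.
Unset Printing Implicit Defensive.

Import Order.TTheory GRing.Theory Num.Theory.

Local Open Scope classical_set_scope.
Local Open Scope ring_scope.

(** * Closed symmetric subsets of affine root systems *)

(** The lattice argument and the Lie theory meet in a short list of properties of the set of roots:
    zero is not a root, roots are closed under negation and have coordinates of one sign, the simple
    roots are roots, no other natural multiple of a simple root is one, and the a_i-string upward
    from x reaches x - <x, a_i^vee> a_i. No classification of affine matrices enters:
    semidefiniteness makes isotropic vectors orthogonal to everything, and every other positive root
    pairs positively with some simple coroot. The weight rho is chosen because e_i f_i v =
    rho(a_i^vee) v, so one module with all these values equal to 1 tests every simple root. The same
    module has a second use: the algebra is known only through generators and relations, and that
    e_i is nonzero, hence that a_i is a root at all, is read off from its action. The obstacle in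
    building the module is the Serre relations. Those in the f_i are checked on all functions on
    words, those in the e_i on the submodule generated by the highest weight vector. *)

Section RootForm.
Variables (R : realType) (l : nat) (A : 'M[int]_l) (d : 'rV[R]_l).
Hypothesis gcmA : is_gcm A.
Hypothesis indA : indecomposable_mx A.
Hypothesis d_gt0 : forall i, 0 < d ord0 i.
Hypothesis symA : (symmetrization d A)^T = symmetrization d A.
Hypothesis psdA : psd (symmetrization d A).

Implicit Types x y z : 'cV[int]_l.
Local Notation S := (symmetrization d A).
Local Notation toR := (map_mx (intr : int -> R)).

(** Vectors of the root lattice are integer columns of coordinates on the simple roots, so that
    signs, heights and the form are matrix computations; [root_vec] later embeds them into the
    weights. *)
Definition simple (i : 'I_l) : 'cV[int]_l := delta_mx i ord0.
Definition coroot_pairing x i : int := (A *m x) i ord0.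
Definition form x y : R := ((toR x)^T *m S *m toR y) ord0 ord0.

Local Notation co := coroot_pairing.

Lemma formE x y :
  form x y = \sum_i (x i ord0)%:~R * (d ord0 i * (co y i)%:~R).
Proof.
rewrite /form /symmetrization -!mulmxA -(map_mxM intr A y) mxE.
apply: eq_bigr => i _; rewrite mul_diag_mx /co !mxE.
by [].
Qed.

Lemma formC x y : form x y = form y x.
Proof.
rewrite /form; have -> : forall M : 'M[R]_1, M ord0 ord0 = M^T ord0 ord0.
  by move=> M; rewrite mxE.
by rewrite 2!trmx_mul trmxK symA mulmxA.
Qed.

Lemma formDl x y z : form (x + y) z = form x z + form y z.
Proof. by rewrite /form map_mxD linearD /= !mulmxDl mxE. Qed.

Lemma formNl x y : form (- x) y = - form x y.
Proof. by rewrite /form map_mxN linearN /= !mulNmx mxE. Qed.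

Lemma form0l y : form 0 y = 0.
Proof. by rewrite /form map_mx0 linear0 !mul0mx mxE. Qed.

Lemma formDr x y z : form x (y + z) = form x y + form x z.
Proof. by rewrite formC formDl !(formC x). Qed.

Lemma formNr x y : form x (- y) = - form x y.
Proof. by rewrite formC formNl formC. Qed.

Lemma form0r x : form x 0 = 0. Proof. by rewrite formC form0l. Qed.

Lemma form_sumr (I : Type) (s : seq I) (F : I -> 'cV[int]_l) x :
  form x (\sum_(i <- s) F i) = \sum_(i <- s) form x (F i).
Proof.
elim/big_ind2: _ => [|y1 a1 y2 a2 <- <-|//]; first exact: form0r.
exact: formDr.
Qed.

Lemma form_ge0 x : 0 <= form x x.
Proof. exact: psdA. Qed.

Lemma formZl a x y : form (a *: x) y = a%:~R * form x y.
Proof. by rewrite /form map_mxZ linearZ /= -!scalemxAl mxE. Qed.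

Lemma formZr a x y : form x (a *: y) = a%:~R * form x y.
Proof. by rewrite formC formZl formC. Qed.

Lemma form_simple x i : form x (simple i) = d ord0 i * (co x i)%:~R.
Proof.
rewrite formC formE (bigD1 i) //= big1 ?addr0 => [|j ji].
  by rewrite mxE !eqxx mul1r.
by rewrite mxE (negPf ji) mul0r.
Qed.

Lemma pairing_simple i j : co (simple j) i = A i j.
Proof. by rewrite /co -colE mxE. Qed.

Lemma pairingD x y i : co (x + y) i = co x i + co y i.
Proof. by rewrite /co mulmxDr mxE. Qed.

Lemma pairingN x i : co (- x) i = - co x i.
Proof. by rewrite /co mulmxN mxE. Qed.

Lemma pairingZ a x i : co (a *: x) i = a * co x i.
Proof. by rewrite /co -scalemxAr mxE. Qed.

Lemma gcm_diag i : A i i = 2.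
Proof. by case: gcmA. Qed.

Lemma norm_simple i : 0 < form (simple i) (simple i).
Proof. by rewrite form_simple pairing_simple gcm_diag mulr_gt0. Qed.

(** Otherwise t -> (t x + y, t x + y) would be a nonconstant affine function of t, which takes
    negative values. *)
Lemma isotropic_radical x y : form x x = 0 -> form x y = 0.
Proof.
move=> x0; apply: contrapT => /eqP xy0.
set b := form x y in xy0 *; set c := form y y.
(* This solves 2 t b + c = -1. It need not be an integer, so semidefiniteness is applied to real
   columns. *)
pose t := - (c + 1) / (2 * b).
have := psdA (t *: toR x + toR y).
have -> : (t *: toR x + toR y)^T = t *: (toR x)^T + (toR y)^T.
  by rewrite linearP.
rewrite !mulmxDl !mulmxDr -!scalemxAl -!scalemxAr.
have -> : forall M1 M2 M3 M4 : 'M[R]_1,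
  (t *: (t *: M1) + t *: M2 + (t *: M3 + M4)) ord0 ord0 =
  t * (t * M1 ord0 ord0) + t * M2 ord0 ord0 + (t * M3 ord0 ord0 + M4 ord0 ord0).
  by move=> *; rewrite !mxE.
rewrite -!/(form _ _) x0 (formC y x) -/b -/c.
have -> : t * (t * 0) + t * b + (t * b + c) = -1 by rewrite /t; field.
by rewrite ler0N1.
Qed.

Lemma form_iso_simple x i : form x x = 0 -> co x i = 0.
Proof.
move=> x0; have /eqP := isotropic_radical (simple i) x0.
by rewrite form_simple mulf_eq0 gt_eqF //= intr_eq0 => /eqP.
Qed.

(** Here A x = 0. In a row j with x_j = 0 all terms A_jm x_m are nonpositive, hence zero, so no
    entry of A joins the zero set of x to its support, against indecomposability. *)
Lemma isotropic_nonneg_pos x : form x x = 0 -> (forall i, 0 <= x i ord0) ->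
  x != 0 -> forall i, 0 < x i ord0.
Proof.
move=> x0 xge0 xn0 i; rewrite lt_def xge0 andbT; apply/eqP => xi0.
pose I := [set i | x i ord0 == 0]%SET.
have [||j [k [jI kI Ajk]]] := indA (I := I).
- by apply/set0Pn; exists i; rewrite inE xi0.
- apply: contraNneq xn0 => IT; apply/eqP/matrixP => j k; rewrite ord1 mxE.
  by have := finset.in_setT j; rewrite -IT inE => /eqP.
move: jI kI; rewrite !inE => /eqP xj0 xk0.
have : - co x j = 0 by rewrite form_iso_simple ?oppr0.
rewrite /co mxE -sumrN => /eqP; rewrite psumr_eq0 => [/allP/(_ k)|m _].
  by rewrite mem_index_enum oppr_eq0 mulf_eq0 (negPf Ajk) (negPf xk0) => /(_ isT).
have [<-|jm] := eqVneq j m; first by rewrite xj0 mulr0 oppr0.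
by rewrite oppr_ge0 mulr_le0_ge0 //; case: gcmA => _ + _; apply.
Qed.


Lemma radical_sub x y : form x x = 0 -> form y y = 0 -> form (x - y) (x - y) = 0.
Proof.
move=> x0 y0; rewrite formDl formNl !formDr !formNr x0 y0.
by rewrite (isotropic_radical y x0) (isotropic_radical x y0) !(oppr0, addr0).
Qed.

(** Off-diagonal entries of A are nonpositive, so u = |x| satisfies (u, u) <= (x, x) = 0. If u = x,
    then x is nonnegative; otherwise the isotropic vector u - x is positive everywhere, that is, x
    is negative. *)
Lemma isotropic_sign x : form x x = 0 -> x != 0 ->
  (forall i, 0 < x i ord0) \/ (forall i, x i ord0 < 0).
Proof.
move=> x0 xn0; pose u := map_mx Num.norm x : 'cV[int]_l.
have u0 : form u u = 0.
  apply/eqP; rewrite eq_le form_ge0 andbT -x0 !formE.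
  apply: ler_sum => i _; rewrite ![_ * (d _ _ * _)]mulrCA ler_pM2l // -!intrM ler_int.
  rewrite /co !mxE !mulr_sumr; apply: ler_sum => j _; rewrite !mxE.
  have [<-|ij] := eqVneq i j.
    by rewrite ![_ * (A i i * _)]mulrCA -normrM ger0_norm // -expr2 sqr_ge0.
  rewrite ![_ * (A i j * _)]mulrCA -normrM.
  rewrite -subr_ge0 -mulrBr mulr_le0 //; first by case: gcmA => _ + _; apply.
  by rewrite subr_le0 ler_norm.
have [ux|ux] := eqVneq (u - x) 0.
  left; apply: isotropic_nonneg_pos => // i.
  by move/eqP: ux; rewrite subr_eq0 => /eqP <-; rewrite mxE.
right=> i; have : 0 < (u - x) i ord0.
  apply: isotropic_nonneg_pos => //; first exact: radical_sub.
  by move=> j; rewrite !mxE subr_ge0 ler_norm.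
by rewrite !mxE subr_gt0; case: (ltrP (x i ord0) 0) => // /ger0_norm ->; rewrite ltxx.
Qed.

Definition reflection i x := x - (co x i) *: simple i.

Lemma reflectionK i : involutive (reflection i).
Proof.
move=> x; rewrite {1}/reflection pairingD pairingN pairingZ pairing_simple gcm_diag.
rewrite /reflection -addrA -opprD -scalerDl -[RHS]subr0; congr (_ - _).
by rewrite (_ : _ + _ = 0) ?scale0r //; ring.
Qed.

Lemma form_reflection i x y : form (reflection i x) (reflection i y) = form x y.
Proof.
rewrite formDl formNl !formDr !formNr !formZl !formZr !(formC (simple i)).
rewrite !form_simple pairing_simple gcm_diag !mulrA; ring.
Qed.

Lemma reflectionD i x y : reflection i (x + y) = reflection i x + reflection i y.
Proof. by rewrite /reflection pairingD scalerDl opprD addrACA. Qed.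

Lemma reflectionN i x : reflection i (- x) = - reflection i x.
Proof. by rewrite /reflection pairingN scaleNr opprD. Qed.


(** * Sets of lattice vectors with the string properties of a root system *)

Section RootSet.
Variable P : set 'cV[int]_l.
Hypothesis P0 : ~ P 0.
Hypothesis PN : forall x, P x -> P (- x).
Hypothesis P_sign : forall x, P x ->
  (forall i, 0 <= x i ord0) \/ (forall i, x i ord0 <= 0).
Hypothesis P_simple : forall i, P (simple i).
Hypothesis P_mul_simple : forall i (k : nat), P (k%:Z *: simple i) -> k = 1%N.
Hypothesis P_string : forall x i (t : nat), P x -> t%:Z <= - co x i ->
  x + t%:Z *: simple i = 0 \/ P (x + t%:Z *: simple i).

Lemma P_neq0 x : P x -> x != 0.
Proof. by apply: contraPneq => ->; exact: P0. Qed.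

(** The reflected vector is the point t = -<x, a_i^vee> of the string when this is nonnegative;
    passing to -x gives the other sign. It is nonzero because the reflection is an involution. *)
Lemma P_reflection i x : P x -> P (reflection i x).
Proof.
wlog coneg : x / co x i <= 0 => [hw Px|Px].
  have [/hw|/ltW copos] := lerP (co x i) 0; first exact.
  rewrite -[reflection _ _]opprK -reflectionN; apply/PN/hw; last exact: PN.
  by rewrite pairingN oppr_le0.
have e : x + `|co x i|%:Z *: simple i = reflection i x.
  by rewrite abszE ler0_norm // scaleNr.
have [|r0|] := @P_string x i `|co x i| Px; last by rewrite e.
  by rewrite abszE ler0_norm.
suff /eqP : x = 0 by rewrite (negPf (P_neq0 Px)).
rewrite -(reflectionK i x) -e r0 /reflection /co mulmx0 mxE.
by rewrite scale0r subr0.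
Qed.

Lemma P_add_simple i y : P y -> form (simple i) y < 0 ->
  simple i + y = 0 \/ P (simple i + y).
Proof.
rewrite formC form_simple pmulr_rlt0 // ltrz0 => Py yi.
have := @P_string y i 1 Py; rewrite scale1r [y + _]addrC; apply.
by move: yi; lia.
Qed.

Definition height x : int := \sum_i x i ord0.

Lemma heightD x y : height (x + y) = height x + height y.
Proof. by rewrite -big_split; apply: eq_bigr => i _; rewrite mxE. Qed.

Lemma heightN x : height (- x) = - height x.
Proof. by rewrite -sumrN; apply: eq_bigr => i _; rewrite mxE. Qed.

Lemma heightZ a x : height (a *: x) = a * height x.
Proof. by rewrite mulr_sumr; apply: eq_bigr => i _; rewrite mxE. Qed.

Lemma height_simple i : height (simple i) = 1.
Proof.
rewrite /height (bigD1 i) //= mxE !eqxx big1 ?addr0 // => j ji.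
by rewrite mxE (negPf ji).
Qed.

Lemma height_ge0 x : (forall i, 0 <= x i ord0) -> 0 <= height x.
Proof. by move=> x_ge0; apply: sumr_ge0. Qed.

Lemma simple_coef i j : simple i j ord0 = (j == i)%:R.
Proof. by rewrite mxE andbT. Qed.

(** Induction on the height of a positive x: simple reflections, applied to x and y together,
    preserve the form and lower x to a simple root, where the string through y decides. *)
Lemma root_add x y : P x -> P y -> form x y < 0 -> x + y = 0 \/ P (x + y).
Proof.
wlog x_ge0 : x y / forall i, 0 <= x i ord0 => [hw Px Py xy|].
  have [/hw|x_le0] := P_sign Px; first exact.
  have [||||e|Pxy] := hw (- x) (- y); try exact: PN.
  - by move=> i; rewrite mxE oppr_ge0.
  - by rewrite formNl formNr opprK.
  - by left; rewrite -[LHS]opprK opprD e oppr0.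
  - by right; rewrite -[x + y]opprK opprD; apply: PN.
move: {2}`|height x|%N (leqnn `|height x|%N) => n.
elim: n x y x_ge0 => [|n IHn] x y x_ge0 htx Px Py xy.
  have : height x <= 0 by move: htx; lia.
  rewrite le_eqVlt ltNge height_ge0 // orbF psumr_eq0 // => /allP x0.
  case/eqP: (P_neq0 Px); apply/matrixP => i j; rewrite ord1 mxE.
  by apply/eqP/x0/mem_index_enum.
(* x is not isotropic, being not orthogonal to y. Hence the sum (x, x) of the x_i d_i <x, a_i^vee>
   is positive and has a positive term. *)
have [i xi] : exists i, 0 < co x i.
  apply: contrapT => /forallNP xi; have : form x x <= 0.
    rewrite formE sumr_le0 // => i _; rewrite mulr_ge0_le0 ?ler0z //.
    by rewrite pmulr_rle0 // lerz0 leNgt; apply/negP.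
  rewrite le_eqVlt ltNge form_ge0 orbF => /eqP /(isotropic_radical y) xy0.
  by rewrite xy0 ltxx in xy.
(* The reflection changes only the i-th coordinate. A positive coordinate elsewhere keeps the
   reflected root positive, with smaller height; without one, x is a multiple of a_i, hence a_i. *)
have [[j [ji xj]]|xsimple] := pselect (exists j, j != i /\ 0 < x j ord0).
  have Psx := P_reflection i Px; have Psy := P_reflection i Py.
  have sx_ge0 : forall k, 0 <= reflection i x k ord0.
    have [//|/(_ j)] := P_sign Psx.
    by rewrite !mxE (negPf ji) mulr0 subr0 leNgt xj.
  have hn : (`|height (reflection i x)| <= n)%N.
    have := height_ge0 sx_ge0; have := height_ge0 x_ge0; move: htx xi.
    by rewrite /reflection heightD heightN heightZ height_simple mulr1; lia.
  have := IHn _ _ sx_ge0 hn Psx Psy.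
  rewrite form_reflection -reflectionD => /(_ xy) [s0|/(P_reflection i)].
    left; rewrite -(reflectionK i (x + y)) s0 -(subrr x).
    by rewrite reflectionD reflectionN !subrr.
  by rewrite reflectionK; right.
have xE : x = `|x i ord0|%:Z *: simple i.
  apply/matrixP => k m; rewrite ord1 !mxE andbT abszE ger0_norm //.
  have [->|ki] := eqVneq k i; first by rewrite mulr1.
  rewrite mulr0; apply/eqP; rewrite eq_le x_ge0 andbT leNgt.
  by apply/negP => xk; apply: xsimple; exists k.
move: (Px) xy; rewrite xE => /P_mul_simple ->; rewrite scale1r.
exact: P_add_simple.
Qed.


(* Climbs from a real root [b <= v] to [v] by adding simple roots.  A step can
   only reach an isotropic root g by g - a_i, and then g + a_i is a root too,
   so the climb never stops below [v]; this replaces the Gabber-Kac theorem. *)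
Lemma isotropic_root_above v b : form v v = 0 ->
  P b -> 0 < form b b -> (forall i, 0 <= b i ord0 <= v i ord0) -> P v.
Proof.
move=> v0.
move: {2}`|height (v - b)|%N (leqnn `|height (v - b)|%N) => n.
elim: n b => [|n IHn] b; rewrite leq_eqVlt => hb Pb bpos b0v.
all: have b_ge0 i : 0 <= b i ord0 by have /andP[] := b0v i.
all: have lebv i : b i ord0 <= v i ord0 by have /andP[] := b0v i.
  have : height (v - b) = 0 by move: hb; lia.
  move=> /eqP; rewrite psumr_eq0 => [/allP vb|i _]; last by rewrite !mxE subr_ge0.
  suff -> : v = b by [].
  apply/matrixP => i j; rewrite ord1; apply/eqP; rewrite -subr_eq0.
  by have := vb i (mem_index_enum i); rewrite !mxE.
have hvb : 0 <= height (v - b).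
  by apply: height_ge0 => i; rewrite !mxE subr_ge0.
(* Without such an i every term of (v - b, v - b) is nonpositive: either v_i = b_i or <v - b,
   a_i^vee> = -<b, a_i^vee> <= 0. Then v - b is isotropic, and so is b, against (b, b) > 0. *)
have [i lti bi] : exists2 i, b i ord0 < v i ord0 & form (simple i) b < 0.
  apply: contrapT => nobi.
  have vb0 : form (v - b) (v - b) = 0.
    apply/eqP; rewrite eq_le form_ge0 andbT formE sumr_le0 // => i _.
    have [lti|] := ltrP (b i ord0) (v i ord0); last first.
      move=> le; have -> : (v - b) i ord0 = 0.
        by rewrite !mxE; apply/eqP; rewrite subr_eq0 eq_le lebv andbT.
      by rewrite mul0r.
    rewrite mulr_ge0_le0 //; first by rewrite ler0z !mxE subr_ge0.
    rewrite pmulr_rle0 // lerz0 pairingD pairingN form_iso_simple // sub0r oppr_le0.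
    rewrite leNgt; apply/negP => bi; apply: nobi; exists i => //.
    by rewrite formC form_simple pmulr_rlt0 // ltrz0.
  have := radical_sub v0 vb0; rewrite opprB addrCA subrr addr0 => b0.
  by rewrite b0 ltxx in bpos.
have step (c : 'cV[int]_l) : (forall j, b j ord0 <= c j ord0 <= v j ord0) ->
    height b < height c -> P c -> 0 < form c c -> P v.
  move=> bcv bc Pc cpos; apply: (IHn c) => // [|j].
    have : 0 <= height (v - c).
      by apply: height_ge0 => j; rewrite !mxE subr_ge0; case/andP: (bcv j).
    by move: hb bc hvb; rewrite !(heightD v) !heightN; lia.
  by have /andP[bcj ->] := bcv j; rewrite (le_trans _ bcj).
have [g gE] : exists g, g = simple i + b by exists (simple i + b).
have bgv j : b j ord0 <= g j ord0 <= v j ord0.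
  rewrite gE mxE simple_coef; case: eqVneq => [->|_]; last by rewrite add0r lexx lebv.
  by rewrite lerDr ler01 addrC lezD1.
have hg : height g = height b + 1 by rewrite gE heightD height_simple addrC.
have [g0|] := P_add_simple Pb bi; last rewrite -gE => Pg.
  have /eqP := congr1 (fun M : 'cV_l => M i ord0) g0.
  by rewrite mxE simple_coef eqxx mxE paddr_eq0 ?ler01 // oner_eq0.
have [g0|gpos] := eqVneq (form g g) 0; last first.
  by apply: (step g) => //; rewrite ?hg ?ltrDl // lt_def gpos form_ge0.
have [->//|gnv] := eqVneq v g.
have vgE k : (v - g) k ord0 = v k ord0 - g k ord0.
  by rewrite mxE [(- g) _ _]mxE.
(* v - g is nonzero, nonnegative and isotropic, hence at least 1 in each coordinate; this leaves g +
   a_i below v. *)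
have vg_gt0 j : 0 < (v - g) j ord0.
  apply: isotropic_nonneg_pos => [|k|]; first exact: radical_sub.
  - by rewrite vgE subr_ge0; case/andP: (bgv k).
  - by rewrite subr_eq0.
apply: (step (g + simple i)) => [j||  |].
- move: (bgv j) (vg_gt0 j); rewrite vgE mxE simple_coef.
  by case: eqVneq => _; rewrite /=; lia.
- by rewrite heightD hg height_simple; lia.
(* g pairs to zero with a_i^vee, so <b, a_i^vee> = -2 and the string from b reaches b + 2 a_i = g +
   a_i. *)
- have bE : b = g - simple i by rewrite gE addrC addKr.
  have [] := P_string (t := 2) (i := i) Pb.
  + by rewrite bE pairingD pairingN pairing_simple gcm_diag form_iso_simple.
  + move=> /(congr1 (fun M : 'cV_l => M i ord0)) /eqP.
    by rewrite mxE [X in _ + X]mxE simple_coef eqxx mxE mulr1 paddr_eq0 // andbC.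
  + by rewrite bE -addrA (_ : 2%:Z = 1 + 1) // scalerDl scale1r addKr.
- rewrite formDl !formDr g0 (formC (simple i)) (isotropic_radical _ g0).
  by rewrite !add0r norm_simple.
Qed.


(** Up to sign every coordinate of v is at least 1, so any simple root lies below v and can start
    the climb. *)
Lemma isotropic_root v : form v v = 0 -> v != 0 -> P v.
Proof.
wlog vpos : v / forall i, 0 < v i ord0 => [hw v0 vn0|v0 vn0].
  have [/hw|vneg] := isotropic_sign v0 vn0; first exact.
  rewrite -[v]opprK; apply: PN; apply: hw => [i||].
  - by rewrite mxE oppr_gt0.
  - by rewrite formNl formNr opprK.
  - by rewrite oppr_eq0.
have [i _] : exists i, v i ord0 != 0.
  apply: contrapT => /forallNP v_eq0; case/eqP: vn0; apply/matrixP => i j.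
  by rewrite ord1 mxE; apply/eqP/negPn/negP/v_eq0.
apply: (@isotropic_root_above v (simple i)) => // [|j]; first exact: norm_simple.
by rewrite simple_coef; have := vpos j; case: (j == i) => /=; lia.
Qed.

Lemma exists_pos_summand (s : seq 'cV[int]_l) x :
  0 < form x (\sum_(y <- s) y) -> exists2 y, y \in s & 0 < form x y.
Proof.
move=> xs; apply: contrapT => ny; move: xs; rewrite form_sumr.
apply/negP; rewrite -leNgt big_seq sumr_le0 // => y ys.
by rewrite leNgt; apply/negP => xy; apply: ny; exists y.
Qed.

Lemma closed_span (Psi : set 'cV[int]_l) (s : seq 'cV[int]_l) :
  Psi `<=` P -> (forall x y, Psi x -> Psi y -> P (x + y) -> Psi (x + y)) ->
  (forall x, Psi x -> Psi (- x)) ->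
  (forall x, x \in s -> Psi x) -> P (\sum_(x <- s) x) -> Psi (\sum_(x <- s) x).
Proof.
move=> PsiP PsiD PsiN.
move: {2}(size s) (leqnn (size s)) => n; elim: n s => [|n IHn] s.
  by rewrite leqn0 size_eq0 => /eqP-> _; rewrite big_nil => /P0.
move=> sz sPsi Ps; have Psi_rem y z : z \in rem y s -> Psi z.
  by move=> /mem_rem; exact: sPsi.
(* Merging: two summands are replaced by their sum, or dropped if the sum is zero. *)
have shorten y z : y \in s -> z \in rem y s -> y + z = 0 \/ Psi (y + z) ->
    Psi (\sum_(x <- s) x).
  move=> ys zs yz; move: Ps; rewrite (big_rem y ys) (big_rem z zs) /= addrA.
  have sz2 : (size (rem z (rem y s)) < n)%N.
    have : (0 < size (rem y s))%N by case: (rem y s) zs.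
    rewrite (size_rem zs) (size_rem ys); move: sz.
    by case: (size s) => [|[|m]].
  have rPsi w : w \in rem z (rem y s) -> Psi w by move=> /mem_rem /Psi_rem.
  case: yz => [->|yz]; first by rewrite add0r => /IHn; apply => //; exact: ltnW.
  have := IHn ((y + z) :: rem z (rem y s)) sz2; rewrite big_cons; apply => w.
  by rewrite inE => /orP[/eqP->//|/rPsi].
set x := \sum_(x <- s) x in Ps shorten *.
have [x0|xn0] := eqVneq (form x x) 0; last first.
  have [|y ys xy] := @exists_pos_summand s x; first by rewrite lt_def xn0 form_ge0.
  have xE : x = y + \sum_(z <- rem y s) z by rewrite /x (big_rem y ys).
  have yP : P y by exact/PsiP/sPsi.
  have [|/eqP|] := root_add Ps (PN yP); first by rewrite formNr oppr_lt0.
    by rewrite subr_eq0 => /eqP ->; exact: sPsi.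
  rewrite {1}xE addrAC subrr add0r => Prem; rewrite xE; apply: PsiD.
  - exact: sPsi.
  - apply: IHn => //; last exact: Psi_rem.
    by rewrite size_rem //; move: sz; case: (s).
  - by rewrite -xE.
have [[y ys yn0]|siso] := pselect (exists2 y, y \in s & form y y != 0).
  have ypos : 0 < form y y by rewrite lt_def yn0 form_ge0.
  (* y is orthogonal to the isotropic x, so the other summands together pair with y to -(y, y) <
     0. *)
  have [z zs yz] : exists2 z, z \in rem y s & 0 < form (- y) z.
    apply: exists_pos_summand; have := isotropic_radical y x0.
    rewrite formC /x (big_rem y ys) /= formDr formNl => /eqP.
    by rewrite addr_eq0 => /eqP <-.
  apply: (shorten y z) => //.
  have yz0 : form y z < 0 by move: yz; rewrite formNl oppr_gt0.
  have [->|yzP] := root_add (PsiP _ (sPsi _ ys)) (PsiP _ (Psi_rem _ _ zs)) yz0.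
    by left.
  right; by apply: PsiD => //; [exact: sPsi|exact: (Psi_rem y)].
subst x; case: s => [|y [|z s]] in sz sPsi Ps x0 Psi_rem shorten siso *.
- by rewrite big_nil in Ps.
- by rewrite big_seq1; apply: sPsi; rewrite inE.
have ys : y \in [:: y, z & s] by rewrite inE eqxx.
have zs : z \in rem y [:: y, z & s] by rewrite /= eqxx inE eqxx.
apply: (shorten y z) => //.
have iso w : w \in [:: y, z & s] -> form w w = 0.
  by move=> ws; apply: contrapT => /eqP wn0; apply: siso; exists w.
have [->|yzn0] := eqVneq (y + z) 0; [by left|right].
apply: PsiD; [exact: sPsi|exact: (Psi_rem y)|apply: isotropic_root => //].
rewrite -[z]opprK; apply: radical_sub; first exact: iso.
by rewrite formNl formNr opprK iso // (mem_rem zs).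
Qed.

End RootSet.
End RootForm.

(** * Lie algebras, modules and sl2-strings *)

Section Subspaces.
Variables (K : fieldType) (V : lmodType K).
Implicit Types N : set V.

Lemma subspaceD N u v : subspace N -> N u -> N v -> N (u + v).
Proof. by move=> [_ NP] Nu Nv; rewrite -[u]scale1r; exact: NP. Qed.

Lemma subspaceZ N a u : subspace N -> N u -> N (a *: u).
Proof. by move=> [N0 NP] Nu; rewrite -[_ *: _]addr0; exact: NP. Qed.

Lemma subspaceN N u : subspace N -> N u -> N (- u).
Proof. by move=> sN Nu; rewrite -scaleN1r; exact: subspaceZ. Qed.

Lemma subspace_sum N (I : eqType) (s : seq I) (F : I -> V) : subspace N ->
  (forall i, i \in s -> N (F i)) -> N (\sum_(i <- s) F i).
Proof.
move=> sN NF; rewrite big_seq; elim/big_ind: _ => [|u v|i /NF//].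
  by case: sN.
exact: subspaceD.
Qed.

Lemma subspace_smallest G : subspace (smallest (@subspace K V) G).
Proof.
split=> [N [[]//]|a u v Nu Nv N sN].
by apply: sN.1.2; [exact: Nu|exact: Nv].
Qed.

Lemma subspace0 : subspace [set (0 : V)].
Proof. by split=> // a u v -> ->; rewrite scaler0 addr0. Qed.

End Subspaces.

Lemma linear_0 (K : fieldType) (U V : lmodType K) (f : U -> V) :
  linear f -> f 0 = 0.
Proof. by move/(_ (-1) 0 0); rewrite !scaleN1r !addNr. Qed.

Section LieTheory.
Variables (K : fieldType) (g : lieAlgType K).
Implicit Types x y z : g.

Lemma lie0l y : lie 0 y = 0.
Proof. exact: linear_0 (lie_linearl y). Qed.
Lemma lie0r x : lie x 0 = 0.
Proof. exact: linear_0 (lie_linearr x). Qed.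
Lemma lieZl a x y : lie (a *: x) y = a *: lie x y.
Proof. by rewrite -[a *: x]addr0 lie_linearl lie0l addr0. Qed.
Lemma lieZr a x y : lie x (a *: y) = a *: lie x y.
Proof. by rewrite -[a *: y]addr0 lie_linearr lie0r addr0. Qed.
Lemma lieDl x y z : lie (x + y) z = lie x z + lie y z.
Proof. by rewrite -{1}[x]scale1r lie_linearl scale1r. Qed.
Lemma lieDr x y z : lie z (x + y) = lie z x + lie z y.
Proof. by rewrite -{1}[x]scale1r lie_linearr scale1r. Qed.
Lemma lieNl x y : lie (- x) y = - lie x y.
Proof. by rewrite -scaleN1r lieZl scaleN1r. Qed.
Lemma lieNr x y : lie x (- y) = - lie x y.
Proof. by rewrite -scaleN1r lieZr scaleN1r. Qed.

Lemma lieC x y : lie x y = - lie y x.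
Proof.
apply/eqP; rewrite -addr_eq0; have := liexx (x + y).
by rewrite lieDl !lieDr !liexx addr0 add0r => ->.
Qed.

Lemma lie_jacobi x y z : lie (lie x y) z = lie x (lie y z) - lie y (lie x z).
Proof.
have := jacobi x y z; rewrite (lieC z (lie x y)) (lieC z x) lieNr => /eqP.
by rewrite subr_eq0 => /eqP <-.
Qed.

Lemma lie_leibniz x y z : lie x (lie y z) = lie (lie x y) z + lie y (lie x z).
Proof. by rewrite lie_jacobi subrK. Qed.

(** Root spaces are by computation the weight spaces of this module, so facts on weights and strings
    are proved once, for modules. *)
Definition adjoint : lie_module g :=
  @LieModule K g g (@lie K g) (@lie_linearl K g) (@lie_linearr K g) lie_jacobi.

Section Module.
Variable V : lie_module g.
Implicit Types u v : V.

Lemma act0l v : act 0 v = 0.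
Proof. exact: linear_0 (act_linearl v). Qed.
Lemma act0r x : act x (0 : V) = 0.
Proof. exact: (@linear_0 _ _ _ (act x) (act_linearr x)). Qed.
Lemma actZl a x v : act (a *: x) v = a *: act x v.
Proof. by rewrite -[a *: x]addr0 act_linearl act0l addr0. Qed.
Lemma actZr a x v : act x (a *: v) = a *: act x v.
Proof. by rewrite -[a *: v]addr0 act_linearr act0r addr0. Qed.
Lemma actDl x y v : act (x + y) v = act x v + act y v.
Proof. by rewrite -{1}[x]scale1r act_linearl scale1r. Qed.
Lemma actDr x u v : act x (u + v) = act x u + act x v.
Proof. by rewrite -{1}[u]scale1r act_linearr scale1r. Qed.
Lemma actNl x v : act (- x) v = - act x v.
Proof. by rewrite -[- x]scaleN1r actZl scaleN1r. Qed.
Lemma act_suml (I : Type) (s : seq I) (F : I -> g) v :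
  act (\sum_(i <- s) F i) v = \sum_(i <- s) act (F i) v.
Proof.
elim/big_ind2: _ => [|x1 a1 x2 a2 <- <-|//]; [exact: act0l|exact: actDl].
Qed.
Lemma act_sumr (I : Type) (s : seq I) (F : I -> V) x :
  act x (\sum_(i <- s) F i) = \sum_(i <- s) act x (F i).
Proof.
elim/big_ind2: _ => [|x1 a1 x2 a2 <- <-|//]; [exact: act0r|exact: actDr].
Qed.

Lemma iter_act0 x n : iter n (act x) (0 : V) = 0.
Proof. by elim: n => //= n ->; exact: act0r. Qed.

Lemma iter_actP x n a u v :
  iter n (act x) (a *: u + v) = a *: iter n (act x) u + iter n (act x) v.
Proof. by elim: n => //= n ->; rewrite actDr actZr. Qed.

(** Each term of the binomial expansion of x^(a+b) (y v) contains (ad x)^p y with p >= a or x^q v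
    with q >= b. Induction on a + b avoids the binomial coefficients. *)
Lemma act_leibniz_nilp x y v a b : iter a (lie x) y = 0 ->
  iter b (act x) v = 0 -> iter (a + b) (act x) (act y v) = 0.
Proof.
move: {2}(a + b)%N (leqnn (a + b)%N) => n.
elim: n a b y v => [|n IHn] [|a] [|b] y v //=.
- by move=> _ -> _; rewrite act0l.
- by move=> _ -> _; rewrite act0l.
- by move=> _ -> _; rewrite act0l -iterS iter_act0.
- by move=> _ _ ->; rewrite act0r -iterS iter_act0.
rewrite -!iterS addSn => abn ya vb; rewrite iterSr.
have -> : act x (act y v) = 1 *: act (lie x y) v + act y (act x v).
  by rewrite scale1r act_lie subrK.
rewrite iter_actP scale1r (IHn a b.+1) -?iterSr // add0r addnS -addSn.
by rewrite (IHn a.+1 b) -?iterSr // addSn -addnS.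
Qed.

End Module.
End LieTheory.

Section SL2.
Variables (K : numFieldType) (g : lieAlgType K).
Implicit Types E F H : g.

Definition sl2_triple E F H :=
  [/\ lie E F = H, lie H E = 2 *: E & lie H F = - (2 *: F)].

Lemma sl2_swap E F H : sl2_triple E F H -> sl2_triple F E (- H).
Proof. by move=> [EF HE HF]; split; rewrite ?lieNl ?HE ?HF ?opprK // lieC EF. Qed.

Variables (E F H : g) (V : lie_module g).
Hypothesis EFH : sl2_triple E F H.
Implicit Types v : V.

Lemma sl2_weight v c n : act H v = c *: v ->
  act H (iter n (act E) v) = (c + 2 * n%:R) *: iter n (act E) v.
Proof.
case: EFH => _ HE _ Hv; elim: n => [|n IHn]; first by rewrite mulr0 addr0.
have -> : act H (iter n.+1 (act E) v) =
    act (lie H E) (iter n (act E) v) + act E (act H (iter n (act E) v)).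
  by rewrite act_lie subrK.
rewrite HE IHn actZr actZl -scalerDl; congr (_ *: _); ring.
Qed.

(** Moving F past n + 1 copies of E subtracts the weights c, c + 2, ..., c + 2n, whose sum is (n +
    1)(c + n). *)
Lemma sl2_lowest v c n : act F v = 0 -> act H v = c *: v ->
  act F (iter n.+1 (act E) v) = - (n.+1%:R * (c + n%:R)) *: iter n (act E) v.
Proof.
move=> Fv Hv; case: (EFH) => EF HE _.
have FE u : act F (act E u) = act E (act F u) - act H u.
  by rewrite -EF act_lie opprB addrC subrK.
elim: n => [|n IHn] /=.
  by rewrite FE Fv Hv act0r sub0r -scaleNr; congr (_ *: _); ring.
rewrite FE IHn actZr (sl2_weight n.+1 Hv) -scalerBl; congr (_ *: _); ring.
Qed.

Lemma sl2_lowest_neq0 v (m n : nat) : act F v = 0 -> act H v = (- m%:R) *: v ->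
  v != 0 -> (n <= m)%N -> iter n (act E) v != 0.
Proof.
move=> Fv Hv vn0; elim: n => //= n IHn nm.
apply: contraNneq (IHn (ltnW nm)) => Ev.
have /eqP := sl2_lowest n Fv Hv; rewrite /= Ev act0r eq_sym scaler_eq0 oppr_eq0.
rewrite mulf_eq0 pnatr_eq0 /= addrC subr_eq0 eqr_nat; case/orP => // /eqP nm'.
by rewrite nm' ltnn in nm.
Qed.

End SL2.

Section SL2String.
Variables (K : numFieldType) (g : lieAlgType K) (E F H : g) (V : lie_module g).
Hypothesis EFH : sl2_triple E F H.
Implicit Types v : V.

(* Descend to the bottom of the F-string of v, then go up again. *)
Lemma sl2_string v (n : nat) : (exists N, iter N (act F) v = 0) -> v != 0 ->
  act H v = (- n%:R) *: v ->
  exists k, forall t, (t <= n)%N -> iter (k + t) (act E) (iter k (act F) v) != 0.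
Proof.
move=> Fnil vn0 Hv.
have exF : exists N, iter N (act F) v == 0 by case: Fnil => N FN; exists N; exact/eqP.
case: (ex_minnP exF) => -[|k] /eqP FN minN.
  by rewrite /= in FN; rewrite FN eqxx in vn0.
(* F^k v is a lowest weight vector of weight -(n + 2k), so E may be applied n + 2k times, and k + t
   is within this bound. *)
exists k => t tn; apply: (@sl2_lowest_neq0 K g E F H V EFH _ (n + 2 * k)) => //.
- have := sl2_weight (sl2_swap EFH) k (v := v) (c := n%:R).
  rewrite !actNl Hv scaleNr opprK => /(_ erefl) /eqP; rewrite eqr_oppLR => /eqP ->.
  by rewrite natrD natrM scaleNr.
- by apply/eqP => Fk; have := minN k; rewrite Fk eqxx ltnn => /(_ isT).
- by move: tn; lia.
Qed.

End SL2String.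

(** * Weights *)

Section Weights.
Variables (K : fieldType) (l : nat) (A : 'M[int]_l) (r : realization K A).
Variables (g : kac_moody r) (V : lie_module g).
Local Notation weight := 'Hom(r, K^o).
Implicit Types (mu nu : weight) (v : V) (N : set V) (C : set weight).

Lemma weight_spaceP mu a u v : weight_space mu u -> weight_space mu v ->
  weight_space mu (a *: u + v).
Proof.
move=> mu_u mu_v h.
by rewrite actDr actZr mu_u mu_v scalerA mulrC -scalerA -scalerDr.
Qed.

Lemma weight_space0 mu : weight_space mu (0 : V).
Proof. by move=> h; rewrite act0r scaler0. Qed.

Lemma weight_spaceZ mu a v : weight_space mu v -> weight_space mu (a *: v).
Proof.
by move=> muv; rewrite -[_ *: _]addr0; apply/weight_spaceP/weight_space0.
Qed.

Lemma weight_space_act alpha mu x v : root_space alpha x -> weight_space mu v ->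
  weight_space (alpha + mu) (act x v).
Proof.
move=> ax muv h; have := act_lie (km_h g h) x v.
rewrite ax actZl muv actZr => /eqP; rewrite eq_sym subr_eq => /eqP ->.
by rewrite -scalerDl lfunE.
Qed.

Definition h_stable N := forall h v, N v -> N (act (km_h g h) v).

Lemma weight_separation mu nu : mu != nu -> exists h, (mu h : K) != nu h.
Proof.
move=> mn; apply: contrapT => /forallNP eqmn; case/eqP: mn.
by apply/lfunP => h; apply/eqP/negPn/negP/eqmn.
Qed.

(** The operator h - nu(h) removes the nu-component, and for a suitable h multiplies the
    mu-component by a nonzero scalar. This h depends on mu; other components may be multiplied by
    zero. *)
Lemma weight_component N (ms : seq weight) (u : weight -> V) :
  subspace N -> h_stable N -> uniq ms -> (forall mu, weight_space mu (u mu)) ->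
  N (\sum_(mu <- ms) u mu) -> forall mu, mu \in ms -> N (u mu).
Proof.
move=> sN hN; elim: ms u => [//|nu ms IHms] u /= /andP[nu_ms ums] wu.
rewrite big_cons => Nsum; have Nms mu : mu \in ms -> N (u mu).
  move=> mu_ms.
  have [h h_mn] : exists h, (mu h : K) != nu h.
    by apply: weight_separation; apply: contraNneq nu_ms => <-.
  pose w (kappa : weight) : V := ((kappa h : K) - nu h) *: u kappa.
  have : N (w mu).
    apply: (IHms w) => // [kappa|]; first exact: weight_spaceZ.
    have -> : \sum_(kappa <- ms) w kappa =
        act (km_h g h) (u nu + \sum_(kappa <- ms) u kappa)
        - (nu h : K) *: (u nu + \sum_(kappa <- ms) u kappa).
      rewrite actDr wu scalerDr opprD addrACA subrr add0r act_sumr.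
      rewrite scaler_sumr -sumrB; apply: eq_bigr => kappa _.
      by rewrite /w wu scalerBl.
    apply: subspaceD => //; first exact: hN.
    by apply: subspaceN => //; exact: subspaceZ.
  move/(subspaceZ ((mu h : K) - nu h)^-1 sN).
  by rewrite scalerA mulVf ?scale1r // subr_eq0.
move=> mu; rewrite inE => /orP[/eqP->|]; last exact: Nms.
have -> : u nu = (u nu + \sum_(kappa <- ms) u kappa) - \sum_(kappa <- ms) u kappa.
  by rewrite addrK.
by apply: subspaceD => //; apply: subspaceN => //; exact: subspace_sum.
Qed.

(** The family [u] consists of weight vectors even off the list, so families can be added and
    extended by zero freely. *)
Definition weight_sum C : set V := [set v | exists (ms : seq weight) u,
  [/\ uniq ms, forall mu, mu \in ms -> C mu,
      forall mu, weight_space mu (u mu) & v = \sum_(mu <- ms) u mu]].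

Lemma weight_sum_subspace C : subspace (weight_sum C).
Proof.
split; first by exists [::], (fun=> 0); split=> //;
  [move=> mu; exact: weight_space0|rewrite big_nil].
move=> a _ _ [ms1 [u1 [ums1 C1 w1 ->]]] [ms2 [u2 [ums2 C2 w2 ->]]].
pose ext (ms : seq weight) (u : weight -> V) mu := if mu \in ms then u mu else 0.
pose ms := undup (ms1 ++ ms2).
have sum_ext ms' u : uniq ms' -> {subset ms' <= ms} ->
    \sum_(mu <- ms') u mu = \sum_(mu <- ms) ext ms' u mu.
  move=> ums' sms; rewrite -big_mkcond -big_filter; apply: perm_big.
  apply: uniq_perm => // [|mu]; first by rewrite filter_uniq ?undup_uniq.
  by rewrite mem_filter; case: (boolP (_ \in _)) => // /sms.
exists ms, (fun mu => a *: ext ms1 u1 mu + ext ms2 u2 mu); split.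
- exact: undup_uniq.
- by move=> mu; rewrite mem_undup mem_cat => /orP[/C1|/C2].
- by move=> mu; apply: weight_spaceP; rewrite /ext; case: ifP => _ //;
    exact: weight_space0.
- rewrite (sum_ext ms1) // => [|mu mu_ms]; last first.
    by rewrite mem_undup mem_cat mu_ms.
  rewrite (sum_ext ms2) // => [|mu mu_ms]; last first.
    by rewrite mem_undup mem_cat mu_ms orbT.
  by rewrite scaler_sumr -big_split.
Qed.

Lemma weight_sum_vec C mu v : C mu -> weight_space mu v -> weight_sum C v.
Proof.
move=> Cmu muv; exists [:: mu], (fun nu => if nu == mu then v else 0); split=> //.
- by move=> nu; rewrite inE => /eqP ->.
- by move=> nu; case: eqVneq => [->//|_]; exact: weight_space0.
- by rewrite big_seq1 eqxx.
Qed.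

Lemma weight_sum_stable C : h_stable (weight_sum C).
Proof.
move=> h _ [ms [u [ums Cms wu ->]]].
rewrite act_sumr; apply: subspace_sum => [|mu mu_ms].
  exact: weight_sum_subspace.
by rewrite wu; apply: (@weight_sum_vec _ mu); [exact: Cms|exact: weight_spaceZ].
Qed.

Lemma weight_sum_mono C C' : C `<=` C' -> weight_sum C `<=` weight_sum C'.
Proof.
by move=> CC' _ [ms [u [ums Cms wu ->]]]; exists ms, u; split=> // mu /Cms/CC'.
Qed.

Lemma weight_sum_act C x alpha : root_space alpha x ->
  (forall mu, C mu -> C (alpha + mu)) -> forall v, weight_sum C v ->
  weight_sum C (act x v).
Proof.
move=> ax aC _ [ms [u [_ Cms wu ->]]]; rewrite act_sumr.
apply: (subspace_sum (weight_sum_subspace C)) => mu /Cms/aC Cmu.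
exact: weight_sum_vec Cmu (weight_space_act ax (wu mu)).
Qed.

(** The difference of v and its decomposition is a vanishing sum over the distinct weights
    [mu :: ms], and [weight_component] for the zero subspace kills each term. *)
Lemma weight_vec_notin C mu v : ~ C mu -> weight_space mu v ->
  weight_sum C v -> v = 0.
Proof.
move=> Cmu muv [ms [u [ums Cms wu vE]]].
have mu_ms : mu \notin ms by apply/negP => /Cms.
pose w nu := if nu == mu then v else - u nu.
have wE nu : nu \in ms -> w nu = - u nu.
  by rewrite /w; case: eqVneq => // ->; rewrite (negPf mu_ms).
have := @weight_component [set 0] (mu :: ms) w (subspace0 V).
move=> /(_ _ _ _ _ mu); rewrite /w eqxx inE eqxx; apply => //.
- by move=> h _ ->; rewrite act0r.
- by rewrite /= mu_ms.
- move=> nu; case: eqVneq => [->//|_]; rewrite -scaleN1r; exact: weight_spaceZ.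
- rewrite big_cons eqxx big_seq (eq_bigr (fun nu => - u nu)) => [|nu /wE //].
  by rewrite -big_seq sumrN {1}vE subrr.
Qed.

Lemma weight_sum_disjoint C C' v : (forall mu, C mu -> ~ C' mu) ->
  weight_sum C v -> weight_sum C' v -> v = 0.
Proof.
move=> CC' [ms [u [ums Cms wu ->]]] C'v.
rewrite big_seq big1 // => mu mu_ms.
apply: (@weight_vec_notin C' mu) => //; first exact/CC'/Cms.
apply: (weight_component (ms := ms)) => //.
  exact: weight_sum_subspace.
exact: weight_sum_stable.
Qed.

End Weights.

(** * Roots of Kac-Moody algebras *)

Section RootVectors.
Variables (K : numFieldType) (l : nat) (A : 'M[int]_l) (r : realization K A).
Local Notation weight := 'Hom(r, K^o).
Implicit Types q : 'cV[int]_l.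

Definition root_vec q : weight := \sum_i (q i ord0)%:~R *: simple_root r i.

Lemma root_vecD q q' : root_vec (q + q') = root_vec q + root_vec q'.
Proof. by rewrite -big_split; apply: eq_bigr => i _; rewrite mxE intrD scalerDl. Qed.

Lemma root_vecN q : root_vec (- q) = - root_vec q.
Proof. by rewrite -sumrN; apply: eq_bigr => i _; rewrite mxE intrN scaleNr. Qed.

Lemma root_vec0 : root_vec 0 = 0.
Proof. by rewrite /root_vec big1 // => i _; rewrite mxE scale0r. Qed.

Lemma root_vec_simple i : root_vec (simple i) = simple_root r i.
Proof.
rewrite /root_vec (bigD1 i) //= big1 ?addr0 => [|j ji].
  by rewrite simple_coef eqxx scale1r.
by rewrite simple_coef (negPf ji) scale0r.
Qed.

Lemma root_vec_inj : injective root_vec.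
Proof.
move=> q q' /eqP; rewrite -subr_eq0 -root_vecN -root_vecD => /eqP q0.
apply/eqP; rewrite -subr_eq0; apply/eqP/matrixP => i j; rewrite ord1 [RHS]mxE.
have /freeP := free_simple_root r; move/(_ (fun i => ((q - q') i ord0)%:~R)).
have -> : \sum_(i < l) ((q - q') i ord0)%:~R *: [tuple simple_root r i | i < l]`_i
    = root_vec (q - q').
  by apply: eq_bigr => k _; rewrite -tnth_nth tnth_mktuple.
by move/(_ q0 i)/eqP; rewrite intr_eq0 => /eqP.
Qed.

Lemma root_vec_coroot q i :
  (root_vec q (simple_coroot r i) : K) = (coroot_pairing A q i)%:~R.
Proof.
rewrite sum_lfunE /coroot_pairing mxE rmorph_sum /=; apply: eq_bigr => j _.
by rewrite lfunE /= simple_rootE intrM mulrC.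
Qed.

End RootVectors.

Section Structure.
Variables (K : numFieldType) (l : nat) (A : 'M[int]_l) (r : realization K A).
Hypothesis gcmA : is_gcm A.
Variable g : kac_moody r.
Local Notation weight := 'Hom(r, K^o).
Local Notation h := (km_h g).
Local Notation e := (km_e g).
Local Notation f := (km_f g).
Local Notation a_ := (simple_root r).
Local Notation av := (simple_coroot r).
Implicit Types (q : 'cV[int]_l) (x y : g).

Lemma km_hh u v : lie (h u) (h v) = 0.
Proof. by case: (km_rel g). Qed.
Lemma km_ef i j : lie (e i) (f j) = if i == j then h (av i) else 0.
Proof. by case: (km_rel g) => _ []. Qed.
Lemma km_he u i : lie (h u) (e i) = (a_ i u : K) *: e i.
Proof. by case: (km_rel g) => _ [_ []]. Qed.
Lemma km_hf u i : lie (h u) (f i) = - ((a_ i u : K) *: f i).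
Proof. by case: (km_rel g) => _ [_ [_ []]]. Qed.
Lemma km_serre_e i j : i != j -> iter `|1 - A i j| (lie (e i)) (e j) = 0.
Proof. by case: (km_rel g) => _ [_ [_ [_ []]]] /[swap] _; apply. Qed.
Lemma km_serre_f i j : i != j -> iter `|1 - A i j| (lie (f i)) (f j) = 0.
Proof. by case: (km_rel g) => _ [_ [_ [_ []]]] _; apply. Qed.

Lemma km_sl2 i : sl2_triple (e i) (f i) (h (av i)).
Proof.
split; first by rewrite km_ef eqxx.
- by rewrite km_he simple_rootE; case: gcmA => ->.
- by rewrite km_hf simple_rootE; case: gcmA => ->.
Qed.

Lemma lie_morphism_iter (phi : g -> g) n x y : lie_morphism phi ->
  phi (iter n (lie x) y) = iter n (lie (phi x)) (phi y).
Proof. by move=> [_ phiM]; elim: n => //= n <-. Qed.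

(** The Chevalley involution, up to signs: -h, f, e satisfy the defining relations again, the two
    families of Serre relations being exchanged. It transfers every statement on the e_i to the
    f_i. *)
Lemma chevalley_exists : exists phi : g -> g,
  [/\ lie_morphism phi, forall u, phi (h u) = - h u,
      forall i, phi (e i) = f i & forall i, phi (f i) = e i].
Proof.
have [|phi [phiM phih phie phif]] :=
    @km_universal _ _ _ _ g g (GRing.opp \o h : {linear r -> g}) f e.
  split=> [u v|]; first by rewrite lieNl lieNr opprK km_hh.
  split=> [i j|].
    by rewrite lieC km_ef eq_sym; case: eqVneq => [->//|_]; rewrite oppr0.
  split=> [u i|]; first by rewrite lieNl km_hf opprK.
  split=> [u i|]; first by rewrite lieNl km_he.
  split=> [i j ij|i j ij]; [exact: km_serre_f|exact: km_serre_e].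
by exists phi.
Qed.

Definition chevalley : g -> g := sval (cid chevalley_exists).
Local Notation omega := chevalley.

Lemma chevalleyM : lie_morphism omega.
Proof. by rewrite /omega; case: cid => phi []. Qed.
Lemma chevalley_h u : omega (h u) = - h u.
Proof. by rewrite /omega; case: cid => phi []. Qed.
Lemma chevalley_e i : omega (e i) = f i.
Proof. by rewrite /omega; case: cid => phi []. Qed.
Lemma chevalley_f i : omega (f i) = e i.
Proof. by rewrite /omega; case: cid => phi []. Qed.
Lemma chevalleyP : linear omega. Proof. by case: chevalleyM. Qed.
Lemma chevalley_lie x y : omega (lie x y) = lie (omega x) (omega y).
Proof. by case: chevalleyM. Qed.
Lemma chevalley0 : omega 0 = 0. Proof. exact: linear_0 chevalleyP. Qed.
Lemma chevalleyZ a x : omega (a *: x) = a *: omega x.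
Proof. by rewrite -[a *: x]addr0 chevalleyP chevalley0 addr0. Qed.
Lemma chevalleyD x y : omega (x + y) = omega x + omega y.
Proof. by rewrite -{1}[x]scale1r chevalleyP scale1r. Qed.
Lemma chevalleyN x : omega (- x) = - omega x.
Proof. by rewrite -[- x]scaleN1r chevalleyZ scaleN1r. Qed.

Lemma km_ind (s : set g) : subalgebra s -> (forall u, s (h u)) ->
  (forall i, s (e i)) -> (forall i, s (f i)) -> forall x, s x.
Proof. by move=> sA sh se sf x; rewrite (km_generated sA sh se sf). Qed.

Lemma chevalleyK : involutive omega.
Proof.
apply: km_ind => [|u|i|i].
- split=> [|x y xE yE]; last by rewrite !chevalley_lie xE yE.
  by split=> [|a x y xE yE]; rewrite ?chevalley0 // !chevalleyP xE yE.
- by rewrite chevalley_h chevalleyN chevalley_h opprK.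
- by rewrite chevalley_e chevalley_f.
- by rewrite chevalley_f chevalley_e.
Qed.

Lemma chevalley_root_space alpha x :
  root_space alpha x -> root_space (- alpha) (omega x).
Proof.
move=> ax u; have := congr1 omega (ax u).
rewrite chevalley_lie chevalley_h lieNl chevalleyZ => /eqP.
by rewrite eqr_oppLR -scaleNr => /eqP ->; rewrite lfunE.
Qed.

Lemma root_systemN alpha : root_system g alpha -> root_system g (- alpha).
Proof.
move=> [an0 [x ax xn0]]; split; first by rewrite oppr_eq0.
exists (omega x); first exact: chevalley_root_space.
by apply: contraNneq xn0 => ox; rewrite -[x]chevalleyK ox chevalley0.
Qed.

Lemma nilp_subalgebra x :
  subalgebra [set y : g | exists n, iter n (lie x) y = 0].
Proof.
split; last first.
  move=> y z [a ya] [b zb]; exists (a + b)%N.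
  exact: (@act_leibniz_nilp K g (adjoint g)).
split; first by exists 0%N.
move=> a y z [n yn] [m zm]; exists (n + m)%N.
rewrite (@iter_actP K g (adjoint g)) /= {1}addnC !iterD yn zm.
by rewrite !(@iter_act0 K g (adjoint g)) scaler0 addr0.
Qed.

Lemma ad_e_nilp i x : exists n, iter n (lie (e i)) x = 0.
Proof.
have ehn u : iter 2 (lie (e i)) (h u) = 0.
  by rewrite /= [lie (e i) (h u)]lieC km_he lieNr lieZr liexx scaler0 oppr0.
move: x; apply: km_ind => [|u|j|j]; first exact: nilp_subalgebra.
- by exists 2.
- have [->|ij] := eqVneq j i; first by exists 1%N; rewrite /= liexx.
  by exists `|1 - A i j|%N; apply: km_serre_e; rewrite eq_sym.
- exists 3; rewrite iterSr km_ef; case: eqVneq => _ //.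
  exact: (@iter_act0 K g (adjoint g)).
Qed.

Lemma ad_f_nilp i x : exists n, iter n (lie (f i)) x = 0.
Proof.
have [n En] := ad_e_nilp i (omega x); exists n.
rewrite -[x]chevalleyK -[f i]chevalley_e -lie_morphism_iter ?En //.
  exact: chevalley0.
exact: chevalleyM.
Qed.

(** * Triangular decomposition and degrees of roots *)

Inductive pos_monomial : 'cV[int]_l -> g -> Prop :=
| PosGen i : pos_monomial (simple i) (e i)
| PosBracket i q x : pos_monomial q x ->
    pos_monomial (simple i + q) (lie (e i) x).

Lemma e_root_space i : root_space (root_vec r (simple i)) (e i).
Proof. by move=> u; rewrite km_he root_vec_simple. Qed.

Lemma f_root_space i : root_space (- root_vec r (simple i)) (f i).
Proof. rewrite -chevalley_e; exact: chevalley_root_space (e_root_space i). Qed.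

Lemma pos_monomial_weight q x : pos_monomial q x -> root_space (root_vec r q) x.
Proof.
elim=> [i|i {}q {}x _ IHx]; first exact: e_root_space.
rewrite root_vecD; apply: (@weight_space_act _ _ _ _ g (adjoint g)) => //.
exact: e_root_space.
Qed.

(** The last clause excludes k a_i for k > 1: nested brackets of that degree vanish because
    [e_i, e_i] = 0. *)
Definition pos_degree : set 'cV[int]_l :=
  [set q : 'cV[int]_l | [/\ forall i, 0 <= q i ord0, q != 0 &
    forall i (k : nat), q = k%:Z *: simple i -> k = 1%N]].

Lemma simple_neq0 (i : 'I_l) : simple i != 0.
Proof. by apply/eqP => /matrixP /(_ i ord0); rewrite simple_coef eqxx mxE. Qed.

(** The induction must record that x is [e i] itself, not just that k = 1: the next bracket with
    [e i] then vanishes. *)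
Lemma pos_monomial_degree q x : pos_monomial q x ->
  [/\ forall i, 0 <= q i ord0, q != 0 &
   forall i (k : nat), q = k%:Z *: simple i -> x = 0 \/ k = 1%N /\ x = e i].
Proof.
elim=> [i|i {}q {}x xq [q_ge0 qn0 IHx]].
  split=> [j||j k]; [by rewrite simple_coef|exact: simple_neq0|].
  move=> /matrixP E; have := E j ord0; have := E i ord0.
  rewrite !mxE !eqxx /= mulr1; case: eqVneq => [->|ij]; last by rewrite mulr0.
  by rewrite mulr1 => -[<-] _; right.
split=> [j||j k E].
- by rewrite mxE simple_coef addr_ge0.
- apply/eqP => /matrixP /(_ i ord0) /eqP.
  by rewrite mxE simple_coef eqxx mxE paddr_eq0.
have Ei := congr1 (fun M : 'cV_l => M i ord0) E.
move: Ei E; rewrite mxE [RHS]mxE !simple_coef eqxx.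
case: eqVneq => [<-{j}|_]; last first.
  by rewrite mulr0 => /eqP; rewrite paddr_eq0.
case: k => [|k] Ek E; first by move: Ek (qn0); have := q_ge0 i; rewrite /=; lia.
left; have [|->|[_ ->]] := IHx i k; [|by rewrite lie0r|by rewrite liexx].
by apply: (addrI (simple i)); rewrite E intS scalerDl scale1r.
Qed.

Definition pos_part : set g := smallest (@subspace K g)
  [set x | exists q, pos_monomial q x].

Lemma pos_part_ind (N : set g) : subspace N ->
  (forall q x, pos_monomial q x -> N x) -> forall x, pos_part x -> N x.
Proof. by move=> sN Nmono x; apply; split=> // y [q]; exact: Nmono. Qed.

Lemma pos_part_subspace : subspace pos_part.
Proof. exact: subspace_smallest. Qed.

Lemma pos_part_mono q x : pos_monomial q x -> pos_part x.
Proof. by move=> xq N [_]; apply; exists q. Qed.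

Lemma pos_part_e i x : pos_part x -> pos_part (lie (e i) x).
Proof.
have sN := pos_part_subspace.
move: x; apply: pos_part_ind => [|q x xq]; last first.
  exact: pos_part_mono (PosBracket i xq).
split=> [|a x y Nx Ny]; first by rewrite lie0r; case: sN.
by rewrite lie_linearr; apply: sN.2.
Qed.

Lemma pos_part_h u x : pos_part x -> pos_part (lie (h u) x).
Proof.
have sN := pos_part_subspace.
move: x; apply: pos_part_ind => [|q x xq]; last first.
  rewrite (pos_monomial_weight xq); apply: (subspaceZ _ sN).
  exact: pos_part_mono xq.
split=> [|a x y Nx Ny]; first by rewrite lie0r; case: sN.
by rewrite lie_linearr; apply: sN.2.
Qed.

Definition borel : set g :=
  [set x | exists u y, pos_part y /\ x = h u + y].

Lemma borel_subspace : subspace borel.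
Proof.
have [N0 NP] := pos_part_subspace.
split; first by exists 0, 0; rewrite linear0 addr0.
move=> a _ _ [u [x [Nx ->]]] [v [y [Ny ->]]].
exists (a *: u + v), (a *: x + y); split; first exact: NP.
by rewrite linearP scalerDr addrACA.
Qed.

Lemma borel_h u : borel (h u).
Proof. by exists u, 0; rewrite addr0; split=> //; case: pos_part_subspace. Qed.

Lemma borel_pos x : pos_part x -> borel x.
Proof. by move=> Nx; exists 0, x; rewrite linear0 add0r. Qed.

Lemma borel_e i x : borel x -> pos_part (lie (e i) x).
Proof.
move=> [u [y [Ny ->]]]; rewrite lieDr lieC km_he -scaleNr.
have sN := pos_part_subspace.
apply: (subspaceD sN); last exact: pos_part_e.
by apply: (subspaceZ _ sN); exact: pos_part_mono (PosGen i).
Qed.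

(** f_i moves down a nested bracket by the Leibniz rule. The Cartan part of [borel] accounts for
    [f_i, e_i], and a further bracket with e_j leads back into [pos_part]. *)
Lemma pos_part_f i x : pos_part x -> borel (lie (f i) x).
Proof.
have sB := borel_subspace; move: x; apply: pos_part_ind => [|q x].
  split=> [|a x y Nx Ny]; first by rewrite lie0r; case: sB.
  by rewrite lie_linearr; apply: sB.2.
have efB j : borel (lie (f i) (e j)).
  rewrite lieC km_ef; apply: (subspaceN sB).
  by case: ifP => _; [exact: borel_h|case: sB].
elim=> [j|j {}q {}x xq IHx]; first exact: efB.
rewrite lie_leibniz; apply: (subspaceD sB);
  last exact: borel_pos (borel_e _ IHx).
rewrite lieC [lie (f i) (e j)]lieC km_ef lieNr opprK.
case: ifP => _; last by rewrite lie0r; case: sB.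
rewrite lieC; apply: (subspaceN sB).
exact: borel_pos (pos_part_h _ (pos_part_mono xq)).
Qed.

Definition triangular : set g :=
  [set x | exists y z, [/\ borel y, pos_part z & x = y + omega z]].

Lemma triangular_subspace : subspace triangular.
Proof.
have [B0 BP] := borel_subspace; have [N0 NP] := pos_part_subspace.
split; first by exists 0, 0; rewrite chevalley0 addr0.
move=> a _ _ [x [x' [Bx Nx' ->]]] [y [y' [By Ny' ->]]].
exists (a *: x + y), (a *: x' + y'); split; [exact: BP|exact: NP|].
by rewrite chevalleyP scalerDr addrACA.
Qed.

Lemma triangular_borel x : borel x -> triangular x.
Proof.
by move=> Bx; exists x, 0; rewrite chevalley0 addr0; split=> //;
  case: pos_part_subspace.
Qed.

Lemma chevalley_triangular x : triangular x -> triangular (omega x).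
Proof.
move=> [_ [z [[u [y [Ny ->]]] Nz ->]]].
exists (- h u + z), y; split=> //; last first.
  by rewrite !chevalleyD chevalleyK chevalley_h -!addrA [z + _]addrC.
by exists (- u), z; rewrite linearN.
Qed.

Lemma triangular_e i x : triangular x -> triangular (lie (e i) x).
Proof.
move=> [y [z [By Nz ->]]]; rewrite lieDr.
have sT := triangular_subspace; apply: (subspaceD sT).
  exact: triangular_borel (borel_pos (borel_e _ By)).
rewrite -[lie _ _]chevalleyK; apply: chevalley_triangular.
rewrite chevalley_lie chevalleyK chevalley_e.
exact: triangular_borel (pos_part_f _ Nz).
Qed.

Lemma triangular_f i x : triangular x -> triangular (lie (f i) x).
Proof.
move=> Tx; rewrite -[lie _ _]chevalleyK; apply: chevalley_triangular.
rewrite chevalley_lie chevalley_f; apply: triangular_e.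
exact: chevalley_triangular.
Qed.

Lemma triangular_h u x : triangular x -> triangular (lie (h u) x).
Proof.
have sT := triangular_subspace.
have Th y : pos_part y -> forall v, triangular (lie (h v) y).
  by move=> Ny v; exact: triangular_borel (borel_pos (pos_part_h _ Ny)).
move=> [_ [z [[v [y [Ny ->]]] Nz ->]]]; rewrite !lieDr km_hh add0r.
apply: (subspaceD sT); first exact: Th.
rewrite -[lie _ _]chevalleyK; apply: chevalley_triangular.
rewrite chevalley_lie chevalleyK chevalley_h -linearN; exact: Th.
Qed.

(** The y whose bracket preserves [triangular] form a subalgebra containing the generators, hence
    all of g. So [triangular] is itself a subalgebra, and it contains the generators. *)
Lemma triangularT x : triangular x.
Proof.
have sT := triangular_subspace.
have idealT y : forall z, triangular z -> triangular (lie y z).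
  move: y; apply: km_ind => [|u|i|i] *;
    [|exact: triangular_h|exact: triangular_e|exact: triangular_f].
  split; first split=> [z Tz|a x1 x2 T1 T2 z Tz].
  - by rewrite lie0l; case: sT.
  - by rewrite lie_linearl; apply: sT.2; [exact: T1|exact: T2].
  move=> x1 x2 T1 T2 z Tz; rewrite lie_jacobi; apply: (subspaceD sT).
    exact: T1 (T2 _ Tz).
  by apply: subspaceN => //; exact: T2 (T1 _ Tz).
have Te i : triangular (e i).
  exact: triangular_borel (borel_pos (pos_part_mono (PosGen i))).
move: x; apply: km_ind => [|u|//|i].
- by split=> // x y _; exact: idealT.
- exact: triangular_borel (borel_h _).
- by rewrite -chevalley_e; exact: chevalley_triangular.
Qed.

Local Notation wsum := (@weight_sum K l A r g (adjoint g)).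

Definition pos_weight : set weight := root_vec r @` pos_degree.

Lemma pos_part_weight x : pos_part x -> wsum pos_weight x.
Proof.
move: x; apply: pos_part_ind => [|q x xq]; first exact: weight_sum_subspace.
have [-> |xn0] := eqVneq x 0.
  by case: (weight_sum_subspace (adjoint g) pos_weight).
apply: (@weight_sum_vec _ _ _ _ _ _ _ (root_vec r q)); last exact: pos_monomial_weight.
have [q_ge0 qn0 qmul] := pos_monomial_degree xq.
exists q => //; split=> // i k /qmul [x0|[]//].
by rewrite x0 eqxx in xn0.
Qed.

Definition signed_weight : set weight :=
  [set alpha | alpha = 0 \/ pos_weight alpha \/ pos_weight (- alpha)].

Lemma triangular_weight x : wsum signed_weight x.
Proof.
have sC := weight_sum_subspace (adjoint g) signed_weight.
have [_ [z [[u [y [Ny ->]]] Nz ->]]] := triangularT x.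
apply: (subspaceD sC); first apply: (subspaceD sC).
- apply: (@weight_sum_vec _ _ _ _ _ _ _ 0); first by left.
  by move=> v; rewrite /= km_hh lfunE /= scale0r.
- by apply: weight_sum_mono (pos_part_weight Ny) => mu; right; left.
have [ms [w [_ Cms ww ->]]] := pos_part_weight Nz.
have -> : omega (\sum_(mu <- ms) w mu) = \sum_(mu <- ms) omega (w mu).
  elim/big_ind2: _ => [|x1 a1 x2 a2 <- <-|//]; first exact: chevalley0.
  exact: chevalleyD.
apply: (subspace_sum sC) => mu mu_ms.
apply: (@weight_sum_vec _ _ _ _ _ _ _ (- mu)).
  by right; right; rewrite opprK; exact: Cms.
exact: chevalley_root_space (ww _).
Qed.

Lemma root_degree alpha : root_system g alpha ->
  exists2 q, alpha = root_vec r q & pos_degree q \/ pos_degree (- q).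
Proof.
move=> [an0 [x ax xn0]].
have : signed_weight alpha.
  apply: contrapT => nC; case/eqP: xn0.
  apply: (@weight_vec_notin K l A r g (adjoint g) signed_weight alpha) => //.
  exact: triangular_weight.
move=> [a0|[[q qpos <-]|[q qpos qE]]].
- by rewrite a0 eqxx in an0.
- by exists q => //; left.
- by exists (- q); [rewrite root_vecN qE opprK|right; rewrite opprK].
Qed.

(** For a root vector x and a suitable k, (ad e_i)^(k+t) (ad f_i)^k x is nonzero by [sl2_string],
    and its weight is that of q + t a_i. *)
Lemma root_string q i (t : nat) : root_system g (root_vec r q) ->
  t%:Z <= - coroot_pairing A q i ->
  q + t%:Z *: simple i = 0 \/ root_system g (root_vec r (q + t%:Z *: simple i)).
Proof.
move=> [_ [x ax xn0]] tq.
have co_neg : coroot_pairing A q i = - (`|coroot_pairing A q i|%N)%:Z.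
  by move: tq; lia.
have [|k /(_ t) Ek] := @sl2_string K g _ _ _ (adjoint g) (km_sl2 i) x
    `|coroot_pairing A q i|%N (ad_f_nilp i x) xn0.
  by rewrite /= ax root_vec_coroot {1}co_neg intrN.
have [-> |qn0] := eqVneq (q + t%:Z *: simple i) 0; [by left|right; split].
  by rewrite -(root_vec0 r) (inj_eq (@root_vec_inj _ _ _ r)).
exists (iter (k + t) (lie (e i)) (iter k (lie (f i)) x)); last first.
  by apply: Ek; move: tq; lia.
have iter_weight (y : g) (c : weight) n mu z : root_space c y ->
    root_space mu z -> root_space (c *+ n + mu) (iter n (lie y) z).
  move=> cy muz; elim: n => [|n IHn] /=; first by rewrite mulr0n add0r.
  rewrite mulrS -addrA.
  exact: (@weight_space_act _ _ _ _ g (adjoint g) _ _ _ _ cy IHn).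
have -> : root_vec r (q + t%:Z *: simple i) =
    root_vec r (simple i) *+ (k + t) + ((- root_vec r (simple i)) *+ k + root_vec r q).
  rewrite mulrnDr mulNrn [_ *+ k + _]addrC -addrA addNKr addrC root_vecD.
  congr (_ + _); elim: (t) => [|n IHn]; first by rewrite scale0r root_vec0.
  by rewrite intS scalerDl scale1r root_vecD IHn mulrS.
exact: iter_weight (e_root_space i) (iter_weight _ _ k _ _ (f_root_space i) ax).
Qed.

Lemma root_mul_simple i (k : nat) :
  root_system g (root_vec r (k%:Z *: simple i)) -> k = 1%N.
Proof.
move=> /root_degree [q /root_vec_inj <- [[_ _ /(_ i k erefl)//]|[]]].
move=> /(_ i); rewrite !mxE !eqxx mulr1 oppr_ge0 => k0.
have -> : k = 0%N by move: k0; lia.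
by rewrite scale0r oppr0 eqxx.
Qed.

Lemma root_sign q : root_system g (root_vec r q) ->
  (forall i, 0 <= q i ord0) \/ (forall i, q i ord0 <= 0).
Proof.
move=> /root_degree [q' /root_vec_inj <- [[q_ge0 _ _]|[q_ge0 _ _]]]; first by left.
by right=> i; have := q_ge0 i; rewrite mxE oppr_ge0.
Qed.

End Structure.

(** * Irreducible highest weight modules *)

Section SubspaceType.
Variables (K : fieldType) (V : lmodType K) (N : set V).

(** The proof of [subspace N] is an argument so that the closure instance can be attached to the
    predicate. *)
Definition in_subspace of subspace N : {pred V} := fun v => `[< N v >].

Variable sN : subspace N.

Lemma in_subspace_closed : subsemimod_closed (in_subspace sN).
Proof.
have [N0 NP] := sN; split; first split; first exact/asboolP.
  by move=> u v /asboolP Nu /asboolP Nv; apply/asboolP; exact: subspaceD.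
by move=> a u /asboolP Nu; apply/asboolP; exact: subspaceZ.
Qed.

HB.instance Definition _ :=
  GRing.isSubmodClosed.Build K V (in_subspace sN) in_subspace_closed.

Record subspace_type := SubspaceType {
  subspace_val :> V;
  subspace_valP : subspace_val \in in_subspace sN
}.

HB.instance Definition _ := [isSub for subspace_val].
HB.instance Definition _ := [Choice of subspace_type by <:].
HB.instance Definition _ := [SubChoice_isSubLmodule of subspace_type by <:].

Definition to_subspace v (Nv : N v) : subspace_type :=
  @SubspaceType v (asboolT Nv).

End SubspaceType.

Section EndomorphismAlgebra.
Variables (K : fieldType) (V : lmodType K).

Lemma linear_subspace : @subspace K (V -> V) [set f | linear f].
Proof.
split=> [a u v|a f1 f2 f1L f2L b u v] /=; first by rewrite scaler0 addr0.
by rewrite !fctE /= f1L f2L !scalerDr addrACA !scalerA mulrC.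
Qed.

Definition gl := subspace_type linear_subspace.
HB.instance Definition _ := GRing.Lmodule.on gl.

Definition gl_fun (x : gl) : V -> V := subspace_val x.
Coercion gl_fun : gl >-> Funclass.

Lemma gl_linear (x : gl) : linear x.
Proof. exact/asboolP/subspace_valP. Qed.

Lemma bracket_linear (x y : gl) : linear ((x \o y) - (y \o x) : V -> V).
Proof.
move=> a u v; rewrite !fctE !gl_linear scalerBr opprD addrACA.
by [].
Qed.

Definition to_gl (f : V -> V) (fL : linear f) : gl :=
  @to_subspace K (V -> V) [set f | linear f] linear_subspace f fL.

Definition bracket (x y : gl) : gl := to_gl (bracket_linear x y).

Lemma bracketE x y v : bracket x y v = x (y v) - y (x v).
Proof. by []. Qed.

Lemma glP (x y : gl) : (forall v, x v = y v) -> x = y.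
Proof. by move=> xy; apply: val_inj; apply/funext. Qed.

Lemma glPE a (x y : gl) v : gl_fun (a *: x + y) v = a *: x v + y v.
Proof. by []. Qed.

Lemma glDE (x y : gl) v : gl_fun (x + y) v = x v + y v.
Proof. by []. Qed.

Lemma glNE (x : gl) v : gl_fun (- x) v = - x v.
Proof. by []. Qed.

Lemma glZE a (x : gl) v : gl_fun (a *: x) v = a *: x v.
Proof. by []. Qed.

Lemma gl_sub (x : gl) u v : x (u - v) = x u - x v.
Proof. by rewrite addrC -scaleN1r gl_linear scaleN1r addrC. Qed.

Lemma bracket_linearl y : linear (bracket^~ y).
Proof.
move=> a x x'; apply: glP => v.
rewrite bracketE !glPE !bracketE gl_linear scalerBr opprD addrACA.
by [].
Qed.

Lemma bracket_linearr x : linear (bracket x).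
Proof.
move=> a y y'; apply: glP => v.
rewrite bracketE !glPE !bracketE gl_linear scalerBr opprD addrACA.
by [].
Qed.

Lemma bracketxx x : bracket x x = 0.
Proof. by apply: glP => v; rewrite bracketE subrr. Qed.

Lemma bracket_jacobi x y z :
  bracket x (bracket y z) + bracket y (bracket z x) + bracket z (bracket x y) = 0.
Proof.
apply: glP => v; rewrite !glDE !bracketE !gl_sub !opprB.
rewrite [X in _ + X + _]addrC [X in X + _]addrACA !subrKA addrACA !subrKA.
by rewrite subrr.
Qed.

HB.instance Definition _ := Lmodule_isLieAlgebra.Build K gl
  bracket_linearl bracket_linearr bracketxx bracket_jacobi.

End EndomorphismAlgebra.

(** * Serre elements and the opposite generators *)

Section SerreCommute.
Variables (K : numFieldType) (l : nat) (A : 'M[int]_l) (r : realization K A).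
Hypothesis gcmA : is_gcm A.
Variables (G : lieAlgType K) (h : r -> G) (e f : 'I_l -> G).
Hypothesis ef : forall i j,
  lie (e i) (f j) = if i == j then h (simple_coroot r i) else 0.
Hypothesis he : forall u i, lie (h u) (e i) = (simple_root r i u : K) *: e i.
Hypothesis hf : forall u i, lie (h u) (f i) = - ((simple_root r i u : K) *: f i).

(** No Serre relation is assumed in G, so this applies to operators on words; with e and f exchanged
    and h negated it also covers the Serre elements in the f_i. *)
Lemma serre_commute i j k : i != j ->
  lie (f k) (iter `|1 - A i j| (lie (e i)) (e j)) = 0.
Proof.
move=> ij; have [gcm_d gcm_le gcm_0] := gcmA.
have nE : `|1 - A i j|%N = `|A i j|%N.+1 by have := gcm_le i j ij; lia.
have fe m n : m != n -> lie (f m) (e n) = 0.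
  by move=> mn; rewrite lieC ef eq_sym (negPf mn) oppr0.
have [ki|ki] := eqVneq k i.
  have sl2 : sl2_triple (e i) (f i) (h (simple_coroot r i)).
    split; first by rewrite ef eqxx.
    - by rewrite he simple_rootE gcm_d.
    - by rewrite hf simple_rootE gcm_d.
  (* e_j is a lowest weight vector of weight a_ij, and the factor a_ij + n in [sl2_lowest] vanishes
     at n = -a_ij. *)
  rewrite nE ki; have := @sl2_lowest K G _ _ _ (adjoint G) sl2 (e j)
    (A i j)%:~R `|A i j|%N.
  rewrite /= fe // he simple_rootE => ->//.
  have -> : (A i j)%:~R + `|A i j|%:R = 0 :> K.
    have -> : A i j = - (`|A i j|%N)%:Z by have := gcm_le i j ij; lia.
    by rewrite intrN abszN addNr.
  by rewrite mulr0 oppr0 scale0r.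
have -> n y : lie (f k) (iter n (lie (e i)) y) = iter n (lie (e i)) (lie (f k) y).
  by elim: n => //= n IHn; rewrite lie_leibniz fe // lie0l add0r IHn.
have it0 n : iter n (lie (e i)) 0 = 0 by exact: (@iter_act0 K G (adjoint G)).
have [->|kj] := eqVneq k j; last by rewrite fe // it0.
(* ad e_i takes [f_j, e_j] to a_ji e_i, and a second ad e_i kills that. If a_ij = 0 there is no
   second one, but then a_ji = 0. *)
rewrite nE iterSr (lieC (f j)) ef eqxx lieNr -lieC he simple_rootE.
have [/gcm_0 -> |Aij] := eqVneq (A i j) 0; first by rewrite scale0r it0.
case: `|A i j|%N (Aij) (absz_gt0 (A i j)) => [->//|n _ _].
by rewrite iterSr lieZr liexx scaler0 it0.
Qed.

End SerreCommute.

(* The contragredient Verma module of highest weight lambda, for the algebra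
   without the Serre relations: a vector u of the Verma module generated by v
   becomes the function i_1 ... i_k |-> coefficient of v in e_(i_k) ... e_(i_1) u
   on words.  Then e_i is a shift, and [e_j, f_i] = delta_ij h_i forces the
   action of f_i. *)
Section Words.
Variables (K : numFieldType) (l : nat) (A : 'M[int]_l) (r : realization K A).
Hypothesis gcmA : is_gcm A.
Variable lambda : 'Hom(r, K^o).
Local Notation words := (seq 'I_l).
Local Notation av := (simple_coroot r).
Implicit Types (phi : words -> K^o) (w : words) (i j : 'I_l) (u : r).

(** A function has weight mu exactly when it is supported on words w with [word_weight w] equal to
    mu. *)
Definition word_weight w : 'Hom(r, K^o) :=
  lambda - \sum_(j <- w) simple_root r j.

Definition word_e i phi : words -> K^o := fun w => phi (i :: w).

Definition word_h u phi : words -> K^o := fun w => (word_weight w u : K) *: phi w.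

(** The value on the empty word is zero because f_i u has no component along the highest weight
    vector. *)
Fixpoint word_f_rec i w phi : K^o :=
  if w is j :: w' then
    word_f_rec i w' (word_e j phi) + (if j == i then word_h (av i) phi w' else 0)
  else 0.
Definition word_f i phi : words -> K^o := fun w => word_f_rec i w phi.

Lemma word_e_linear i : linear (word_e i).
Proof. by []. Qed.

Lemma word_h_linear u : linear (word_h u).
Proof.
move=> a phi psi; apply/funext => w.
by rewrite /word_h !fctE scalerDr !scalerA mulrC.
Qed.

Lemma word_f_linear i : linear (word_f i).
Proof.
move=> a phi psi; apply/funext => w; rewrite /word_f !fctE.
elim: w phi psi => [|j w IHw] phi psi /=; first by rewrite scaler0 addr0.
rewrite word_e_linear IHw scalerDr addrACA; congr (_ + _).
case: ifP => _; last by rewrite scaler0 addr0.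
by rewrite word_h_linear.
Qed.

Definition gl_e i : gl (words -> K^o) := to_gl (word_e_linear i).
Definition gl_h u : gl (words -> K^o) := to_gl (word_h_linear u).
Definition gl_f i : gl (words -> K^o) := to_gl (word_f_linear i).

Lemma word_weight_cons j w : word_weight (j :: w) = word_weight w - simple_root r j.
Proof. by rewrite /word_weight big_cons opprD addrCA addrC. Qed.

Lemma word_hE u phi w : word_h u phi w = (word_weight w u : K) *: phi w.
Proof. by []. Qed.

Lemma word_f_cons i phi j w : word_f i phi (j :: w) =
  word_f i (word_e j phi) w + (if j == i then word_h (av i) phi w else 0).
Proof. by []. Qed.

Lemma word_weight_consE j w u :
  (word_weight (j :: w) u : K) = word_weight w u - simple_root r j u.
Proof. by rewrite word_weight_cons add_lfunE opp_lfunE. Qed.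

Lemma gl_hh u v : lie (gl_h u) (gl_h v) = 0.
Proof.
apply: glP => phi; apply/funext => w.
rewrite [LHS](_ : _ = word_h u (word_h v phi) w - word_h v (word_h u phi) w) //.
by rewrite /word_h !scalerA mulrC subrr.
Qed.

Lemma gl_ef i j : lie (gl_e i) (gl_f j) = if i == j then gl_h (av i) else 0.
Proof.
apply: glP => phi; apply/funext => w.
rewrite [LHS](_ : _ = word_f j phi (i :: w) - word_f j (word_e i phi) w) //.
rewrite /word_f /= addrC addKr.
by case: eqVneq => [->|].
Qed.

Lemma gl_he u i : lie (gl_h u) (gl_e i) = (simple_root r i u : K) *: gl_e i.
Proof.
apply: glP => phi; apply/funext => w.
rewrite [LHS](_ : _ = word_h u (word_e i phi) w - word_h u phi (i :: w)) //.
rewrite [RHS](_ : _ = (simple_root r i u : K) *: phi (i :: w)) //.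
by rewrite /word_h /word_e -scalerBl word_weight_consE subKr.
Qed.

Lemma gl_hf u i : lie (gl_h u) (gl_f i) = - ((simple_root r i u : K) *: gl_f i).
Proof.
apply: glP => phi; apply/funext => w.
rewrite [LHS](_ : _ = word_h u (word_f i phi) w - word_f i (word_h u phi) w) //.
rewrite [RHS](_ : _ = - ((simple_root r i u : K) *: word_f i phi w)) //.
elim: w phi => [|j w IHw] phi.
  by rewrite /word_h /word_f /= scaler0 subrr scaler0 oppr0.
have eh : word_e j (word_h u phi) =
    - (simple_root r j u : K) *: word_e j phi + word_h u (word_e j phi).
  apply/funext => w'; rewrite !fctE /word_e /word_h -scalerDl.
  by rewrite word_weight_consE addrC.
have := IHw (word_e j phi).
rewrite word_hE (word_hE u (word_f i phi)) word_weight_consE !word_f_cons.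
rewrite eh word_f_linear !fctE.
move: (word_f i (word_e j phi) w) (word_f i (word_h u (word_e j phi)) w) => x y xy.
case: eqVneq => [->|_]; last first.
  by rewrite !addr0 -xy scalerBl scaleNr opprD opprK addrA subrK.
rewrite !word_hE.
have alg (c a b t X Y : K) : c * X - Y = - (a * X) ->
    (c - a) * (X + b * t) - (- a * X + Y + b * (c * t)) = - (a * (X + b * t)).
  move=> E; have -> : Y = c * X + a * X by rewrite -[a * X]opprK -E; ring.
  by ring.
exact: alg xy.
Qed.

Definition hw_vec : words -> K^o := fun w => if w is [::] then 1 else 0.

(** Closing under the f_i alone gives an induction with a single generating step; stability under h
    and the e_i then follows from the commutation relations. *)
Definition hw_set : set (words -> K^o) :=
  smallest [set N : set (words -> K^o) |
    subspace N /\ forall i phi, N phi -> N (word_f i phi)] [set hw_vec].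

Lemma hw_set_ind (N : set (words -> K^o)) : subspace N ->
  (forall i phi, N phi -> N (word_f i phi)) -> N hw_vec ->
  forall phi, hw_set phi -> N phi.
Proof. by move=> sN fN Nhw phi; apply; split=> // _ ->. Qed.

Lemma hw_set_subspace : subspace hw_set.
Proof.
split=> [N [[[]]]//|a u v Lu Lv N [[sN fN] vN]].
by apply: sN.2; [apply: Lu|apply: Lv].
Qed.

Lemma hw_set_f i phi : hw_set phi -> hw_set (word_f i phi).
Proof. by move=> Lphi N NP; apply: NP.1.2; exact: Lphi. Qed.

Lemma hw_set_vec : hw_set hw_vec.
Proof. by move=> N [_]; apply. Qed.

Lemma gl_commute (x y : gl (words -> K^o)) phi :
  x (y phi) = gl_fun (lie x y) phi + y (x phi).
Proof. by rewrite [gl_fun (lie x y) phi]bracketE subrK. Qed.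

Lemma glNZE a (x : gl (words -> K^o)) phi :
  gl_fun (- (a *: x)) phi = - (a *: x phi).
Proof. by rewrite glNE glZE. Qed.

Lemma hw_set_h u phi : hw_set phi -> hw_set (word_h u phi).
Proof.
have sL := hw_set_subspace => Lphi.
(* Membership of phi is carried along because moving h past f_i leaves a multiple of f_i phi. *)
suff [] : hw_set phi /\ hw_set (word_h u phi) by [].
move: phi Lphi; apply: hw_set_ind => [|i phi [Lphi Lh]|].
- split=> [|a phi psi [Lphi Lphi'] [Lpsi Lpsi']].
    by split; [case: sL|rewrite (linear_0 (word_h_linear u)); case: sL].
  by split; [exact: sL.2|rewrite word_h_linear; exact: sL.2].
- split; first exact: hw_set_f.
  have := gl_commute (gl_h u) (gl_f i) phi; rewrite gl_hf glNZE.
  rewrite [gl_h u _](_ : _ = word_h u (word_f i phi)) // => ->.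
  apply: (subspaceD sL); last exact: hw_set_f.
  apply: (subspaceN sL); apply: (subspaceZ _ sL); exact: hw_set_f.
- split; first exact: hw_set_vec.
  have -> : word_h u hw_vec = (lambda u : K) *: hw_vec.
    apply/funext => -[|j w]; rewrite word_hE !fctE /= ?scaler0 //.
    by rewrite /word_weight big_nil subr0.
  apply: (subspaceZ _ sL); exact: hw_set_vec.
Qed.

Lemma word_e_vec i : word_e i hw_vec = 0.
Proof. by apply/funext. Qed.

Lemma hw_set_e i phi : hw_set phi -> hw_set (word_e i phi).
Proof.
have sL := hw_set_subspace => Lphi.
suff [] : hw_set phi /\ hw_set (word_e i phi) by [].
move: phi Lphi; apply: hw_set_ind => [|j phi [Lphi Le]|].
- split=> [|a phi psi [Lphi Lphi'] [Lpsi Lpsi']].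
    by split; case: sL.
  by split; [exact: sL.2|rewrite word_e_linear; exact: sL.2].
- split; first exact: hw_set_f.
  have := gl_commute (gl_e i) (gl_f j) phi; rewrite gl_ef.
  rewrite [gl_e i _](_ : _ = word_e i (word_f j phi)) // => ->.
  apply: (subspaceD sL); last exact: hw_set_f.
  by case: (i == j); [exact: hw_set_h|case: sL].
- by split; [exact: hw_set_vec|rewrite word_e_vec; case: sL].
Qed.

(* The Serre elements in the e_i commute with all f_k and kill the highest
   weight vector. *)
Lemma serre_e_zero i j phi : i != j -> hw_set phi ->
  gl_fun (iter `|1 - A i j| (lie (gl_e i)) (gl_e j)) phi = 0.
Proof.
move=> ij; set x := iter _ _ _ => Lphi; move: phi Lphi.
apply: hw_set_ind => [|k phi xphi|].
- split=> [|a phi psi xphi xpsi]; first exact: linear_0 (gl_linear x).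
  by rewrite gl_linear xphi xpsi scaler0 addr0.
- have := gl_commute (gl_f k) x phi.
  rewrite (serre_commute gcmA gl_ef gl_he gl_hf k ij) xphi add0r.
  rewrite (linear_0 (gl_linear (gl_f k))) => /esym.
  by [].
- have e_iter n : gl_fun (iter n (lie (gl_e i)) (gl_e j)) hw_vec = 0.
    elim: n => [|n IHn]; first exact: word_e_vec.
    rewrite [LHS]bracketE IHn [gl_e i hw_vec]word_e_vec.
    by rewrite !(linear_0 (gl_linear _)) subrr.
  exact: e_iter.
Qed.

(* The Serre elements in the f_i commute with all e_k and take values vanishing
   on the empty word. *)
Lemma serre_f_zero i j phi : i != j ->
  gl_fun (iter `|1 - A i j| (lie (gl_f i)) (gl_f j)) phi = 0.
Proof.
move=> ij; set x := iter _ _ _.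
have f_iter0 n psi : gl_fun (iter n (lie (gl_f i)) (gl_f j)) psi [::] = 0.
  elim: n psi => //= n IHn psi.
  rewrite [LHS](_ : _ = gl_f i (gl_fun (iter n (lie (gl_f i)) (gl_f j)) psi) [::]
    - gl_fun (iter n (lie (gl_f i)) (gl_f j)) (gl_f i psi) [::]) //.
  by rewrite IHn subr0.
apply/funext => w; elim: w phi => [|k w IHw] phi; first exact: f_iter0.
(* Relations for the exchanged roles: f raises, e lowers, and h is negated. *)
have fe a b : lie (gl_f a) (gl_e b) = if a == b then - gl_h (av a) else 0.
  by rewrite lieC gl_ef eq_sym; case: eqVneq => [->|] //; rewrite oppr0.
have xk0 : lie (gl_e k) x = 0.
  apply: (@serre_commute K l A r gcmA _ (fun u => - gl_h u) _ _ fe) => // u m.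
    by rewrite lieNl gl_hf opprK.
  by rewrite lieNl gl_he.
have := congr1 (fun y : words -> K^o => y w) (gl_commute (gl_e k) x phi).
rewrite xk0 => E; rewrite [LHS](_ : _ = gl_e k (gl_fun x phi) w) // E.
by rewrite !fctE add0r IHw.
Qed.

End Words.

(** * Restriction of operators to a stable subspace *)

Section Restriction.
Variables (K : fieldType) (V : lmodType K) (N : set V) (sN : subspace N).
Local Notation W := (subspace_type sN).

Lemma subspace_mem (v : W) : N v.
Proof. exact/asboolP/subspace_valP. Qed.

Lemma subspace_val_inj (u v : W) : subspace_val u = subspace_val v -> u = v.
Proof. exact: val_inj. Qed.

Lemma subspace_valPE a (u v : W) :
  subspace_val (a *: u + v) = a *: subspace_val u + subspace_val v.
Proof. by []. Qed.

Definition stable (x : gl V) := forall v, N v -> N (x v).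

Section Restrict.
Variables (x : gl V) (xN : stable x).

Definition restrict_fun (v : W) : W := to_subspace sN (xN (subspace_mem v)).

Lemma restrict_linear : linear restrict_fun.
Proof.
by move=> a u v; apply: subspace_val_inj; rewrite /= gl_linear.
Qed.

Definition restrict : gl W := to_gl restrict_linear.
End Restrict.

(** Relations are transferred through this correspondence, so brackets and iterated brackets require
    no stability proof of their own. *)
Definition restricts (X : gl W) (x : gl V) :=
  forall v : W, subspace_val (X v) = x (subspace_val v).

Lemma restrictP x (xN : stable x) : restricts (restrict xN) x.
Proof. by []. Qed.

Lemma restricts_eq X x Y y : restricts X x -> restricts Y y ->
  (forall v, N v -> x v = y v) -> X = Y.
Proof.
move=> Xx Yy xy; apply: glP => v; apply: subspace_val_inj.
by rewrite Xx Yy xy //; exact: subspace_mem.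
Qed.

Lemma restricts_P a X x Y y : restricts X x -> restricts Y y ->
  restricts (a *: X + Y) (a *: x + y).
Proof. by move=> Xx Yy v; rewrite !glPE subspace_valPE Xx Yy. Qed.

Lemma restricts0 : restricts 0 0.
Proof. by []. Qed.

Lemma restrictsZ a X x : restricts X x -> restricts (a *: X) (a *: x).
Proof.
by move=> Xx; have := restricts_P a Xx restricts0; rewrite !addr0.
Qed.

Lemma restrictsN X x : restricts X x -> restricts (- X) (- x).
Proof. by move/(restrictsZ (-1)); rewrite !scaleN1r. Qed.

Lemma restricts_lie X x Y y : restricts X x -> restricts Y y ->
  restricts (lie X Y) (lie x y).
Proof.
move=> Xx Yy v; rewrite [LHS](_ : _ = subspace_val (X (Y v) - Y (X v))) //.
by rewrite addrC -scaleN1r subspace_valPE !Xx !Yy Xx scaleN1r addrC.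
Qed.

Lemma restricts_iter X x Y y n : restricts X x -> restricts Y y ->
  restricts (iter n (lie X) Y) (iter n (lie x) y).
Proof. by move=> Xx Yy; elim: n => //= n; exact: restricts_lie. Qed.

End Restriction.

(** * The irreducible module of highest weight lambda *)

Section HighestWeight.
Variables (K : numFieldType) (l : nat) (A : 'M[int]_l) (r : realization K A).
Hypothesis gcmA : is_gcm A.
Variables (g : kac_moody r) (lambda : 'Hom(r, K^o)).
Local Notation words := (seq 'I_l).
Local Notation av := (simple_coroot r).
Local Notation h := (km_h g).
Local Notation e := (km_e g).
Local Notation f := (km_f g).

Local Notation hw_space := (subspace_type (hw_set_subspace lambda)).

Definition hw_e i : gl hw_space :=
  @restrict _ _ _ (hw_set_subspace lambda) (gl_e K i) (@hw_set_e _ _ _ _ lambda i).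
Definition hw_f i : gl hw_space :=
  @restrict _ _ _ (hw_set_subspace lambda) (gl_f lambda i) (@hw_set_f _ _ _ _ lambda i).
Definition hw_h u : gl hw_space :=
  @restrict _ _ _ (hw_set_subspace lambda) (gl_h lambda u) (@hw_set_h _ _ _ _ lambda u).

Lemma hw_h_linear : linear hw_h.
Proof.
move=> a u v.
have hP w : restricts (hw_h w) (gl_h lambda w) by exact: restrictP.
apply: (restricts_eq (hP _) (restricts_P a (hP u) (hP v))) => phi _.
apply/funext => w.
rewrite glPE [LHS](_ : _ = word_h lambda (a *: u + v) phi w) // !fctE.
rewrite [gl_h lambda u phi w](_ : _ = word_h lambda u phi w) //.
rewrite [gl_h lambda v phi w](_ : _ = word_h lambda v phi w) //.
by rewrite !word_hE linearP scalerDl scalerA.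
Qed.

HB.instance Definition _ :=
  GRing.isLinear.Build K r (gl hw_space) *:%R hw_h hw_h_linear.

Lemma hw_relations : km_relations hw_h hw_e hw_f.
Proof.
have hP u : restricts (hw_h u) (gl_h lambda u) by exact: restrictP.
have eP i : restricts (hw_e i) (gl_e K i) by exact: restrictP.
have fP i : restricts (hw_f i) (gl_f lambda i) by exact: restrictP.
have o : restricts (0 : gl hw_space) 0 by exact: restricts0.
split=> [u v|].
  by apply: (restricts_eq (restricts_lie (hP u) (hP v)) o) => phi _; rewrite gl_hh.
split=> [i j|].
  have := gl_ef lambda i j; case: (i == j) => E.
    by apply: (restricts_eq (restricts_lie (eP i) (fP j)) (hP _)) => phi _; rewrite E.
  by apply: (restricts_eq (restricts_lie (eP i) (fP j)) o) => phi _; rewrite E.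
split=> [u i|].
  apply: (restricts_eq (restricts_lie (hP u) (eP i)) (restrictsZ _ (eP i))) => phi _.
  by rewrite gl_he.
split=> [u i|].
  apply: (restricts_eq (restricts_lie (hP u) (fP i))
    (restrictsN (restrictsZ _ (fP i)))) => phi _.
  by rewrite gl_hf.
split=> i j ij.
  apply: (restricts_eq (restricts_iter _ (eP i) (eP j)) o) => phi Lphi.
  by rewrite (serre_e_zero gcmA ij Lphi).
apply: (restricts_eq (restricts_iter _ (fP i) (fP j)) o) => phi Lphi.
by rewrite (serre_f_zero gcmA lambda _ ij).
Qed.


Definition hw_rep_exists := @km_universal _ _ _ _ g (gl hw_space) hw_h hw_e hw_f
  hw_relations.
Definition hw_rep : g -> gl hw_space := sval (cid hw_rep_exists).

Lemma hw_repM : lie_morphism hw_rep.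
Proof. by rewrite /hw_rep; case: cid => phi []. Qed.
Lemma hw_rep_h u : hw_rep (h u) = hw_h u.
Proof. by rewrite /hw_rep; case: cid => phi []. Qed.
Lemma hw_rep_e i : hw_rep (e i) = hw_e i.
Proof. by rewrite /hw_rep; case: cid => phi []. Qed.
Lemma hw_rep_f i : hw_rep (f i) = hw_f i.
Proof. by rewrite /hw_rep; case: cid => phi []. Qed.

Lemma hw_act_linearl (v : hw_space) : linear (fun x => hw_rep x v).
Proof. by move=> a x y; rewrite hw_repM.1 glPE. Qed.

Lemma hw_act_lie x y (v : hw_space) :
  hw_rep (lie x y) v = hw_rep x (hw_rep y v) - hw_rep y (hw_rep x v).
Proof. by rewrite hw_repM.2. Qed.

Definition hw_module : lie_module g :=
  @LieModule K g hw_space (fun x => hw_rep x) hw_act_linearl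
    (fun x => gl_linear (hw_rep x)) hw_act_lie.
Local Notation V := hw_module.

Definition word_of (v : V) : words -> K^o := subspace_val (v : hw_space).

Lemma word_of_inj : injective word_of.
Proof. by move=> u v /subspace_val_inj. Qed.

Lemma word_ofP a (u v : V) w : word_of (a *: u + v) w = a *: word_of u w + word_of v w.
Proof. by []. Qed.

Lemma word_of_e i (v : V) : word_of (act (e i) v) = word_e i (word_of v).
Proof. by rewrite /= hw_rep_e. Qed.
Lemma word_of_f i (v : V) : word_of (act (f i) v) = word_f lambda i (word_of v).
Proof. by rewrite /= hw_rep_f. Qed.
Lemma word_of_h u (v : V) : word_of (act (h u) v) = word_h lambda u (word_of v).
Proof. by rewrite /= hw_rep_h. Qed.

Definition hw_vector : V := to_subspace (hw_set_subspace lambda)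
  (@hw_set_vec K l A r lambda).

Lemma hw_module_ind (N : set V) : subspace N ->
  (forall i v, N v -> N (act (f i) v)) -> N hw_vector -> forall v, N v.
Proof.
move=> sN fN Nv v.
suff [v' /word_of_inj <-] : exists2 v', word_of v' = word_of v & N v' by [].
have : hw_set lambda (word_of v) by exact: subspace_mem.
move: (word_of v); apply: hw_set_ind => [|i phi [u <- Nu]|].
- split; first by exists 0 => //; case: sN.
  move=> a phi psi [u <- Nu] [u' <- Nu']; exists (a *: u + u') => //.
  exact: sN.2.
- by exists (act (f i) u); [rewrite word_of_f|exact: fN].
- by exists hw_vector.
Qed.

Lemma hw_vector_e i : act (e i) hw_vector = 0.
Proof. by apply: word_of_inj; rewrite word_of_e; exact: word_e_vec. Qed.

Lemma hw_vector_weight : weight_space lambda hw_vector.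
Proof.
move=> u; apply: word_of_inj; rewrite word_of_h; apply/funext => -[|j w].
  by rewrite word_hE /word_weight big_nil subr0.
by rewrite word_hE [RHS](_ : _ = (lambda u : K) *: 0) // !scaler0.
Qed.

Lemma hw_vector_neq0 : hw_vector != 0.
Proof.
apply/eqP => /(congr1 (fun v => word_of v [::])) /eqP.
by rewrite [X in X == _](_ : _ = 1) // [X in _ == X](_ : _ = 0) // oner_eq0.
Qed.

(** The value of v at [i :: w] is that of e_i v at w, so a vector killed by all e_i is supported on
    the empty word. *)
Lemma word_of_eq0 (v : V) : word_of v [::] = 0 -> (forall i, act (e i) v = 0) ->
  v = 0.
Proof.
move=> v0 ev; apply: word_of_inj; apply/funext => -[|i w]; first exact: v0.
by rewrite -[LHS]/(word_e i (word_of v) w) -word_of_e ev.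
Qed.


Lemma hw_module_weight_sum (v : V) : weight_sum setT v.
Proof.
move: v; apply: hw_module_ind => [|i v wv|]; first exact: weight_sum_subspace.
  exact: (weight_sum_act (f_root_space g i)).
exact: weight_sum_vec hw_vector_weight.
Qed.

Lemma hw_module_weight : weight_module V.
Proof.
split=> [v|ms u ums wu u0 mu mu_ms].
  have [ms [u [_ _ wu vE]]] := hw_module_weight_sum v.
  by exists ms, u.
apply: (weight_component (subspace0 V) _ ums wu) => // x v ->.
exact: act0r.
Qed.

Lemma hw_vector_cyclic : cyclic_submodule hw_vector = setT.
Proof.
apply/seteqP; split=> // v _ N [[sN aN] Nv].
apply: hw_module_ind => // [i u|]; first exact: aN.
exact: Nv.
Qed.

Lemma hw_module_hw : highest_weight_module V lambda.
Proof.
split; first exact: hw_module_weight.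
exists hw_vector; split; [exact: hw_vector_neq0|exact: hw_vector_e|
  exact: hw_vector_weight|exact: hw_vector_cyclic].
Qed.

Lemma word_weight_neq i w : word_weight lambda (i :: w) != lambda.
Proof.
rewrite /word_weight -subr_eq0 addrAC subrr add0r oppr_eq0.
pose q (s : words) : 'cV[int]_l := \sum_(j <- s) simple j.
have qE s : root_vec r (q s) = \sum_(j <- s) simple_root r j.
  elim: s => [|j s IHs]; first by rewrite /q !big_nil root_vec0.
  by rewrite /q !big_cons root_vecD root_vec_simple -IHs.
have q_ge0 s j : 0 <= q s j ord0.
  rewrite summxE sumr_ge0 // => k _; rewrite simple_coef; exact: ler0n.
rewrite -qE -(root_vec0 r) (inj_eq (@root_vec_inj _ _ _ r)); apply/eqP.
move=> /(congr1 (fun M : 'cV_l => M i ord0)) /eqP.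
rewrite /q big_cons -/(q w) mxE simple_coef eqxx mxE paddr_eq0 ?ler01 //.
Qed.

Lemma top_weight (v : V) : weight_space lambda v -> v = word_of v [::] *: hw_vector.
Proof.
move=> wv; apply: word_of_inj; apply/funext => -[|i w].
  by rewrite [RHS](_ : _ = word_of v [::] * 1) // mulr1.
rewrite [RHS](_ : _ = word_of v [::] *: 0) // scaler0.
have [u] := weight_separation (word_weight_neq i w).
rewrite -subr_eq0; set c := _ - _ => cn0.
have := congr1 (fun v => word_of v (i :: w)) (wv u).
rewrite word_of_h word_hE [RHS](_ : _ = (lambda u : K) *: word_of v (i :: w)) //.
move=> /eqP; rewrite -subr_eq0 -scalerBl scaler_eq0 (negPf cn0) => /eqP.
by [].
Qed.

Lemma bottom_weight mu (v : V) : weight_space mu v -> word_of v [::] != 0 ->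
  mu = lambda.
Proof.
move=> wv vn0; apply/lfunP => u.
have := congr1 (fun v => word_of v [::]) (wv u).
rewrite word_of_h word_hE [RHS](_ : _ = (mu u : K) *: word_of v [::]) //.
rewrite /word_weight big_nil subr0 => /eqP.
rewrite -subr_eq0 -scalerBl scaler_eq0 (negPf vn0) orbF subr_eq0 => /eqP.
by [].
Qed.

Lemma word_of_sum (ms : seq 'Hom(r, K^o)) (u : 'Hom(r, K^o) -> V) w :
  word_of (\sum_(mu <- ms) u mu) w = \sum_(mu <- ms) word_of (u mu) w.
Proof.
elim: ms => [|mu ms IHms]; first by rewrite !big_nil.
by rewrite !big_cons -IHms -[u mu]scale1r word_ofP !scale1r.
Qed.

(** If v in N is nonzero at a word w, applying the e_i along w gives an element of N that is nonzero
    at the empty word. Its component of weight lambda lies in N and is a nonzero multiple of the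
    generator. *)
Lemma hw_module_irreducible : irreducible V.
Proof.
split=> [|N [sN aN]]; first by exists hw_vector; exact: hw_vector_neq0.
have [[v Nv vn0]|N0] := pselect (exists2 v, N v & v != 0); last first.
  left; apply/seteqP; split=> [v Nv|_ ->]; last by case: sN.
  by apply: contrapT => vn0; apply: N0; exists v => //; exact/eqP.
right; have [v' Nv' vn0'] : exists2 v', N v' & word_of v' [::] != 0.
  have [w] : exists w, word_of v w != 0.
    apply: contrapT => /forallNP v0; case/eqP: vn0; apply: word_of_inj.
    by apply/funext => w; apply/eqP/negPn/negP/v0.
  elim: w v Nv {vn0} => [|i w IHw] v Nv vw; first by exists v.
  apply: (IHw (act (e i) v)); first exact: aN.
  by rewrite word_of_e.
have [ms [u [ums _ wu vE]]] := hw_module_weight_sum v'.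
have hN : h_stable N by move=> x y; exact: aN.
have Nu : forall mu, mu \in ms -> N (u mu).
  by apply: (weight_component sN hN ums wu); rewrite -vE.
have [mu mu_ms umu] : exists2 mu, mu \in ms & word_of (u mu) [::] != 0.
  apply: contrapT => nomu; case/eqP: vn0'.
  rewrite vE word_of_sum big_seq big1 // => mu mu_ms.
  by apply: contrapT => /eqP umu; apply: nomu; exists mu.
have := Nu mu mu_ms; have muE := bottom_weight (wu mu) umu.
have wmu : weight_space lambda (u mu) by rewrite -{1}muE.
rewrite (top_weight wmu) => /(subspaceZ (word_of (u mu) [::])^-1 sN).
rewrite scalerA mulVf // scale1r => Nhw.
apply/seteqP; split=> // x _; apply: hw_module_ind => // i y; exact: aN.
Qed.


Lemma nilp_submodule x : (forall y : g, exists n, iter n (lie x) y = 0) ->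
  submodule [set v : V | exists n, iter n (act x) v = 0].
Proof.
move=> xnil; split; last first.
  move=> y v _ [b vb]; have [a ya] := xnil y; exists (a + b)%N.
  exact: act_leibniz_nilp.
split; first by exists 0%N.
move=> a u v [n un] [m vm]; exists (n + m)%N.
rewrite iter_actP {1}addnC !iterD un vm !iter_act0.
by rewrite scaler0 addr0.
Qed.

Lemma hw_module_nilp x : (forall y : g, exists n, iter n (lie x) y = 0) ->
  (exists n, iter n (act x) hw_vector = 0) -> locally_nilpotent V x.
Proof.
move=> /nilp_submodule xN xv v; have : setT v by [].
by rewrite -hw_vector_cyclic => /(_ _ (conj xN _)); apply=> _ ->.
Qed.

(** With n = lambda(a_i^vee), f_i^(n+1) v is zero at the empty word, being a value of f_i, and is
    killed by every e_k: for k = i by the vanishing coefficient in [sl2_lowest], otherwise because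
    e_k commutes with f_i. Hence it is zero. *)
Lemma hw_module_integrable : (forall i, exists n : nat, (lambda (av i) : K) = n%:R) ->
  integrable V.
Proof.
move=> dom i; split; apply: hw_module_nilp.
- exact: ad_e_nilp.
- by exists 1%N; exact: hw_vector_e.
- exact: ad_f_nilp.
have [n ln] := dom i; exists n.+1; apply: word_of_eq0.
  by rewrite /iter -/(iter n _ _) word_of_f.
move=> k; have [->|ki] := eqVneq k i.
  rewrite (sl2_lowest (c := - n%:R) (sl2_swap (km_sl2 gcmA g i))).
  - by rewrite addNr mulr0 oppr0 scale0r.
  - exact: hw_vector_e.
  - by rewrite actNl hw_vector_weight ln scaleNr.
elim: n.+1 => [|m IHm]; first exact: hw_vector_e.
have := act_lie (e k) (f i) (iter m (act (f i)) hw_vector).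
by rewrite km_ef (negPf ki) act0l IHm act0r subr0 => <-.
Qed.

End HighestWeight.

Section Existence.
Variables (K : numFieldType) (l : nat) (A : 'M[int]_l) (r : realization K A).
Hypothesis gcmA : is_gcm A.
Variable g : kac_moody r.

(** rho is the sum of the coordinate forms attached to the linearly independent simple coroots. *)
Lemma exists_rho : exists rho : 'Hom(r, K^o),
  forall i, (rho (simple_coroot r i) : K) = 1.
Proof.
pose X := [tuple simple_coroot r i | i < l].
exists (\sum_j linfun (coord X j : r -> K^o)) => i.
rewrite sum_lfunE (bigD1 i) //= big1 => [|j ji].
  have -> : simple_coroot r i = X`_i by rewrite -tnth_nth tnth_mktuple.
  by rewrite lfunE /= coord_free ?free_simple_coroot // eqxx addr0.
have -> : simple_coroot r i = X`_i by rewrite -tnth_nth tnth_mktuple.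
by rewrite lfunE /= coord_free ?free_simple_coroot // eq_sym (negPf ji).
Qed.

Lemma exists_integrable_module :
  exists (V : lie_module g) (lambda : 'Hom(r, K^o)) (v : V),
  [/\ irreducible V, integrable V, highest_weight_module V lambda,
      weight_space lambda v & forall i, act (km_e g i) (act (km_f g i) v) = v /\
        v != 0].
Proof.
have [rho rho1] := exists_rho.
exists (hw_module gcmA g rho), rho, (hw_vector gcmA g rho); split.
- exact: hw_module_irreducible.
- by apply: hw_module_integrable => i; exists 1%N.
- exact: hw_module_hw.
- exact: hw_vector_weight.
move=> i; split; last exact: hw_vector_neq0.
have := act_lie (km_e g i) (km_f g i) (hw_vector gcmA g rho).
rewrite km_ef eqxx hw_vector_e act0r subr0 => <-.
by rewrite hw_vector_weight rho1 scale1r.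
Qed.

(** e_i acts nontrivially, since e_i f_i v = v is nonzero; so the relations do not collapse it. *)
Lemma km_e_neq0 i : km_e g i != 0.
Proof.
have [V [lambda [v [_ _ _ _ ev]]]] := exists_integrable_module.
by have [efv] := ev i; apply: contraNneq => e0; rewrite -efv e0 act0l.
Qed.

Lemma simple_root_system i : root_system g (root_vec r (simple i)).
Proof.
split; last by exists (km_e g i); [exact: e_root_space|exact: km_e_neq0].
by rewrite -(root_vec0 r) (inj_eq (@root_vec_inj _ _ _ r)) simple_neq0.
Qed.

End Existence.

(** * Wide regular subalgebras *)

Section ClosedHull.
Variables (K : numFieldType) (l : nat) (A : 'M[int]_l) (r : realization K A).
Variable g : kac_moody r.
Local Notation weight := 'Hom(r, K^o).
Implicit Types S : set weight.

Lemma root_system_closed : closed_subset g (root_system g).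
Proof. by split. Qed.

Lemma closed_hull_sub S : S `<=` root_system g -> closed_hull g S `<=` root_system g.
Proof. by move=> SR alpha; apply; split=> //; exact: root_system_closed. Qed.

Lemma sub_closed_hull S : S `<=` closed_hull g S.
Proof. by move=> alpha Sa N [_]; apply. Qed.

Lemma closed_hull_add S alpha beta : closed_hull g S alpha -> closed_hull g S beta ->
  root_system g (alpha + beta) -> closed_hull g S (alpha + beta).
Proof. by move=> Sa Sb ab N NP; apply: NP.1.2 => //; [exact: Sa|exact: Sb]. Qed.

(** The roots whose negatives lie in the hull form a closed set containing S. *)
Lemma closed_hull_opp S : S `<=` root_system g ->
  (forall alpha, S alpha -> S (- alpha)) ->
  forall alpha, closed_hull g S alpha -> closed_hull g S (- alpha).
Proof.
move=> SR SN alpha Sa; apply: (Sa [set a | closed_hull g S (- a)]).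
split=> [|beta /SN]; last exact: sub_closed_hull.
split=> [beta /(closed_hull_sub SR)/root_systemN|beta gamma Sb Sc bc].
  by rewrite opprK.
rewrite /= opprD; apply: closed_hull_add => //.
by rewrite -opprD; exact: root_systemN.
Qed.

Lemma adjoint_weight_sum (x : g) : @weight_sum _ _ _ _ g (adjoint g) setT x.
Proof. exact: weight_sum_mono (triangular_weight x). Qed.

(** Since s is stable under the Cartan subalgebra, it contains the weight components of its
    elements. A component of weight zero preserves each weight; the others shift weights by elements
    of [roots_of s]. *)
Lemma regular_submodule (s : set g) (V : lie_module g) (C : set weight) :
  regular_subalgebra s ->
  (forall alpha mu, roots_of s alpha -> C mu -> C (alpha + mu)) ->
  submodule_on s (@weight_sum _ _ _ _ g V C).
Proof.
move=> [[sS _] sh] sC; have sW := weight_sum_subspace V C.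
split=> // x v sx Cv; have [ms [u [ums _ wu xE]]] := adjoint_weight_sum x.
have su : forall mu, mu \in ms -> s (u mu).
  by apply: (@weight_component _ _ _ _ g (adjoint g) s ms u) => //; rewrite -xE.
rewrite xE act_suml; apply: (subspace_sum sW) => alpha alpha_ms.
have [->|un0] := eqVneq (u alpha) 0; first by rewrite act0l; case: sW.
apply: (weight_sum_act (wu alpha)) Cv => mu Cmu.
have [->|an0] := eqVneq alpha 0; first by rewrite add0r.
apply: sC => //; split.
  by split=> //; exists (u alpha) => //; exact: wu.
apply/eqP => /seteqP[/(_ (u alpha)) h _]; case/eqP: un0; apply: h.
by split; [exact: su|exact: wu].
Qed.

End ClosedHull.

Section Main.
Variables (K : numFieldType) (l : nat) (A : 'M[int]_l) (r : realization K A).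
Hypothesis gcmA : is_gcm A.
Variables (g : kac_moody r) (s : set g).
Hypotheses (reg_s : regular_subalgebra s) (wide_s : wide s).
Local Notation weight := 'Hom(r, K^o).
Local Notation Psi := (closed_hull g (roots_of s `|` -%R @` roots_of s)).

Lemma roots_sub : roots_of s `|` -%R @` roots_of s `<=` root_system g.
Proof. by move=> alpha [[]//|[beta [Rb _] <-]]; exact: root_systemN. Qed.

Lemma hull_opp alpha : Psi alpha -> Psi (- alpha).
Proof.
apply: closed_hull_opp; first exact: roots_sub.
move=> beta [Tb|[gamma Tc <-]]; first by right; exists beta.
by left; rewrite opprK.
Qed.

(** Sums with repetition already form a group, the hull being symmetric; a list of summands is also
    the form in which [closed_span] takes its input. *)
Definition hull_lattice : set 'cV[int]_l := [set q | exists qs : seq 'cV[int]_l,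
  (forall q', q' \in qs -> Psi (root_vec r q')) /\ q = \sum_(q' <- qs) q'].

Lemma hull_latticeD q q' : hull_lattice q -> hull_lattice q' -> hull_lattice (q + q').
Proof.
move=> [qs [Sqs ->]] [qs' [Sqs' ->]]; exists (qs ++ qs'); rewrite big_cat.
by split=> // p; rewrite mem_cat => /orP[/Sqs|/Sqs'].
Qed.

Lemma hull_latticeN q : hull_lattice q -> hull_lattice (- q).
Proof.
move=> [qs [Sqs ->]]; exists (map -%R qs); rewrite big_map sumrN.
by split=> // _ /mapP[p /Sqs Sp ->]; rewrite root_vecN; exact: hull_opp.
Qed.

Lemma hull_lattice_vec q : Psi (root_vec r q) -> hull_lattice q.
Proof.
by move=> Sq; exists [:: q]; rewrite big_seq1; split=> // _ /[!inE] /eqP ->.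
Qed.

Lemma hull_lattice0 : hull_lattice 0.
Proof. by exists [::]; rewrite big_nil. Qed.

Lemma hull_lattice_simple i : hull_lattice (simple i).
Proof.
have [V [lambda [v [irrV intV hwV wv ev]]]] := exists_integrable_module gcmA g.
have [_ vn0] := ev i.
pose C := [set mu : weight | exists2 q, hull_lattice q & mu = lambda + root_vec r q].
have shiftC alpha mu : roots_of s alpha -> C mu -> C (alpha + mu).
  move=> Ta [q Lq ->]; have [q' aE _] := root_degree Ta.1.
  exists (q' + q); last by rewrite root_vecD -aE addrCA.
  apply: hull_latticeD => //; apply: hull_lattice_vec.
  by rewrite -aE; apply: sub_closed_hull; left.
(* The complement of the coset is stable too, because the lattice contains the negatives of the
   roots of s. *)
have shiftNC alpha mu : roots_of s alpha -> (~` C) mu -> (~` C) (alpha + mu).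
  move=> Ta nC [q Lq E]; apply: nC; have [q' aE _] := root_degree Ta.1.
  exists (q - q'); last by rewrite root_vecD root_vecN -aE addrA -E addrC addKr.
  apply: hull_latticeD => //; apply: hull_latticeN; apply: hull_lattice_vec.
  by rewrite -aE; apply: sub_closed_hull; left.
have sub1 := regular_submodule V reg_s shiftC.
have sub2 := regular_submodule V reg_s shiftNC.
have [||N10|N20] := wide_s irrV intV hwV sub1 sub2.
- move=> w; have [ms [u [wu ->]]] := hwV.1.1 w.
  pose N := [set x : V | exists v1 v2,
    [/\ weight_sum C v1, weight_sum (~` C) v2 & x = v1 + v2]].
  have sN : subspace N.
    split; first by exists 0, 0; rewrite addr0; split=> //; [case: sub1.1|case: sub2.1].
    move=> a _ _ [u1 [u2 [Cu1 Cu2 ->]]] [v1 [v2 [Cv1 Cv2 ->]]].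
    exists (a *: u1 + v1), (a *: u2 + v2); split; [exact: sub1.1.2|exact: sub2.1.2|].
    by rewrite scalerDr addrACA.
  apply: (subspace_sum sN) => mu _; have [Cmu|nCmu] := pselect (C mu).
    exists (u mu), 0; rewrite addr0; split=> //; last by case: sub2.1.
    exact: weight_sum_vec Cmu (wu mu).
  exists 0, (u mu); rewrite add0r; split=> //; first by case: sub1.1.
  exact: weight_sum_vec nCmu (wu mu).
- apply/seteqP; split=> [w [Cw nCw]|_ ->]; last by split; [case: sub1.1|case: sub2.1].
  by apply: weight_sum_disjoint Cw nCw => mu Cmu; apply.
- case/eqP: vn0; suff : weight_sum C v by rewrite N10.
  by apply: weight_sum_vec wv; exists 0; [exact: hull_lattice0|rewrite root_vec0 addr0].
have fv := weight_space_act (f_root_space g i) wv.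
(* Otherwise f_i v lies in the summand that is zero, against e_i f_i v = v. *)
have : C (- root_vec r (simple i) + lambda).
  apply: contrapT => nC; case/eqP: vn0; have [efv _] := ev i.
  have : weight_sum (~` C) (act (km_f g i) v) by exact: weight_sum_vec fv.
  by rewrite N20 => /= f0; rewrite -efv f0 act0r.
move=> [q Lq]; rewrite addrC => /addrI; rewrite -root_vecN => /root_vec_inj E.
by rewrite -[simple i]opprK E; exact: hull_latticeN.
Qed.

Lemma hull_latticeT q : hull_lattice q.
Proof.
have nat_mul (n : nat) i : hull_lattice (n%:Z *: simple i).
  elim: n => [|n IHn]; first by rewrite scale0r; exact: hull_lattice0.
  rewrite intS scalerDl scale1r; apply: hull_latticeD => //.
  exact: hull_lattice_simple.
have -> : q = \sum_i q i ord0 *: simple i.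
  apply/matrixP => i j; rewrite ord1 summxE (bigD1 i) //= big1 => [|k ki].
    by rewrite mxE simple_coef eqxx mulr1 addr0.
  by rewrite mxE simple_coef eq_sym (negPf ki) mulr0.
apply: (big_ind hull_lattice); [exact: hull_lattice0|exact: hull_latticeD|move=> i _].
case: (q i ord0) => n; first exact: nat_mul.
by rewrite NegzE scaleNr; apply: hull_latticeN; exact: nat_mul.
Qed.

End Main.

Theorem theorem3p5 (R : realType) (l : nat) (A : 'M[int]_l)
    (affA : affine_gcm R A) (r : realization R[i] A) (g : kac_moody r)
    (s : set g) (reg_s : regular_subalgebra s) (wide_s : wide s) :
  closed_hull g (roots_of s `|` -%R @` roots_of s) = root_system g.
Proof.
have [gcmA indA [d [d_gt0 symA psdA _]]] := affA.
apply/seteqP; split; first by apply: closed_hull_sub; exact: roots_sub.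
move=> alpha Ra; have [q aE _] := root_degree Ra.
have [qs [Sqs qE]] := hull_latticeT gcmA reg_s wide_s q.
(* The form is real while the roots live over [R[i]]; integer coordinates are the common ground. *)
pose P := [set q : 'cV[int]_l | root_system g (root_vec r q)].
pose S := [set q : 'cV[int]_l |
  closed_hull g (roots_of s `|` -%R @` roots_of s) (root_vec r q)].
rewrite aE qE.
apply: (@closed_span R l A d gcmA indA d_gt0 symA psdA P _ _ _ _ _ _ S qs) => //.
- by move=> [+ _]; rewrite root_vec0 eqxx.
- by move=> x Px; rewrite /P /= root_vecN; exact: root_systemN.
- by move=> x; exact: root_sign.
- by move=> i; exact: simple_root_system.
- by move=> i k; exact: root_mul_simple.
- by move=> x i t Px; exact: root_string.
- by move=> x Sx; apply: closed_hull_sub Sx; exact: roots_sub.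
- by move=> x y Sx Sy; rewrite /P /S /= root_vecD; exact: closed_hull_add.
- by move=> x Sx; rewrite /S /= root_vecN; exact: hull_opp.
- by rewrite /P /= -qE -aE.
Qed.
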